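(* Let $n\ge 2$ and let $\mathcal{E}_1$ and $\mathcal{E}_2$ be two ellipsoids in $\mathbb{R}^n$ centered at the origin such that $\widetilde V_i(\mathcal{E}_1)=\widetilde V_i(\mathcal{E}_2)$ for every $i=1,2,\ldots,n$. Then $\mathcal{E}_1$ and $\mathcal{E}_2$ are congruent.
   Context: An ellipsoid in $\mathbb{R}^n$ centered at the origin is the image, under some orthogonal transformation, of a set of the form $\{x\in\mathbb{R}^n: \frac{x_1^2}{a_1^2}+\cdots+\frac{x_n^2}{a_n^2}\le 1\}$ with semi-axes $a_1,\ldots,a_n>0$. For a star body $K\subset\mathbb{R}^n$ (in particular an ellipsoid centered at the origin) the radial function is $\rho_K(\theta)=\max\{a\ge 0: a\theta\in K\}$, $\theta\in S^{n-1}$. The $i$-th dual volume of $K$ is $$\widetilde V_i(K)=\frac1n\int_{S^{n-1}}\rho_K(\theta)^i\,d\theta,$$ where the integration is with respect to the spherical Lebesgue (surface) measure on $S^{n-1}$. Two sets are congruent if one is the image of the other under an isometry of $\mathbb{R}^n$. *)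

(* Defs.v *)
From HB Require Import structures.
From mathcomp Require Import all_boot all_order all_algebra.
From mathcomp Require Import all_classical all_reals all_analysis.
From mathcomp Require Import measurable_realfun.

Set Implicit Arguments.
Unset Strict Implicit.
Unset Printing Implicit Defensive.

Import Order.TTheory GRing.Theory Num.Theory.
Import numFieldNormedType.Exports.

Local Open Scope classical_set_scope.
Local Open Scope ring_scope.

(* The norm `|x| that the library puts on 'rV[R]_n is the sup norm. *)
Definition enorm (R : realType) (n : nat) (x : 'rV[R]_n) : R :=
  Num.sqrt (\sum_(i < n) x 0 i ^+ 2).

Definition orthogonal_mx (R : realType) (n : nat) (U : 'M[R]_n) : Prop :=
  U *m U^T = 1%:M.

Definition is_isometry (R : realType) (n : nat) (f : 'rV[R]_n -> 'rV[R]_n) :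
    Prop :=
  bijective f /\ forall x y, enorm (f x - f y) = enorm (x - y).

Definition congruent (R : realType) (n : nat) (A B : set 'rV[R]_n) : Prop :=
  exists2 f : 'rV[R]_n -> 'rV[R]_n, is_isometry f & B = f @` A.

Definition axis_ellipsoid (R : realType) (n : nat) (a : 'I_n -> R) :
    set 'rV[R]_n :=
  [set x | \sum_(i < n) x 0 i ^+ 2 / a i ^+ 2 <= 1].

Definition centered_ellipsoid (R : realType) (n : nat) (E : set 'rV[R]_n) :
    Prop :=
  exists (a : 'I_n -> R) (U : 'M[R]_n),
    [/\ forall i, 0 < a i, orthogonal_mx U &
        E = (fun x => x *m U) @` axis_ellipsoid a].

(* For a star body the set below is a compact interval [0, b] when theta is on
   the unit sphere, so that the supremum is the maximum. *)
Definition radial (R : realType) (n : nat) (K : set 'rV[R]_n)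
    (theta : 'rV[R]_n) : R :=
  sup [set a : R | 0 <= a /\ K (a *: theta)].

Definition rV_display : measure_display.
Proof. by constructor. Qed.

(* The sigma-algebra generated by the coordinates, i.e. the Borel one. *)
Section measurable_rV.
Variables (R : realType) (n : nat).

Let coord (i : 'I_n) (x : 'rV[R]_n) : R := x 0 i.

HB.instance Definition _ := @isMeasurable.Build rV_display
  'rV[R]_n (g_sigma_preimage coord) (@sigma_algebra0 _ setT _)
  (@sigma_algebraC _ _) (@sigma_algebra_bigcup _ setT _).

Lemma measurable_coord (i : 'I_n) :
  measurable_fun setT ((fun x => x 0 i) : 'rV[R]_n -> R).
Proof.
move=> _ Y mY; rewrite setTI; apply: sub_sigma_algebra => /=.
rewrite -bigcup_seq/=; exists i => /=; first by rewrite mem_index_enum.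
by exists Y => //; rewrite setTI.
Qed.

Lemma measurable_fun_rV d (T : measurableType d) (f : T -> 'rV[R]_n) :
  (forall i, measurable_fun setT ((fun x => f x 0 i) : T -> R)) ->
  measurable_fun setT f.
Proof.
move=> mf; apply: (@measurability _ _ _ _ _ _
  (\big[setU/set0]_(i < n) preimage_set_system setT (coord i) measurable)) => //.
move=> _ [A + <-]; rewrite -bigcup_seq => -[i _ [B mB <-]].
by rewrite !setTI -comp_preimage -[X in measurable X]setTI; exact: mf.
Qed.

End measurable_rV.

Section lebesgue_rV.
Variable R : realType.

Definition row_cons n (p : measurableTypeR R * 'rV[R]_n) : 'rV[R]_n.+1 := row_mx (p.1)%:M p.2.

Lemma measurable_row_cons n : measurable_fun setT (@row_cons n).
Proof.
apply: measurable_fun_rV => i.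
case: (@splitP 1 n i) => j ij.
  rewrite (_ : (fun p => _) = fst) //; apply/funext => p.
  have -> : i = lshift n j by exact/val_inj.
  by apply: (etrans (row_mxEl _ _ _ _)); rewrite mxE !ord1.
have -> : i = rshift 1 j by exact/val_inj.
rewrite (_ : (fun p => _) = (fun x : 'rV[R]_n => x 0 j) \o snd).
  by apply: measurableT_comp => //; exact: measurable_coord.
by apply/funext => p /=; exact: row_mxEr.
Qed.

Section step.
Variables (n : nat) (mu : {sigma_finite_measure set 'rV[R]_n -> \bar R}).

Definition lebesgue_rV_succ : set 'rV[R]_n.+1 -> \bar R :=
  pushforward (lebesgue_measure \x mu)%E (@row_cons n).

Let mrow_cons := @measurable_row_cons n.

Let lebesgue_rV_succ0 : lebesgue_rV_succ set0 = 0%E.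
Proof. exact: measure0. Qed.

Let lebesgue_rV_succ_ge0 A : (0 <= lebesgue_rV_succ A)%E.
Proof. exact: measure_ge0. Qed.

Let lebesgue_rV_succ_sigma_additive : semi_sigma_additive lebesgue_rV_succ.
Proof. exact: measure_semi_sigma_additive. Qed.

HB.instance Definition _ := isMeasure.Build _ _ _ lebesgue_rV_succ
  lebesgue_rV_succ0 lebesgue_rV_succ_ge0 lebesgue_rV_succ_sigma_additive.

Let lebesgue_rV_succ_sigma_finite : sigma_finite setT lebesgue_rV_succ.
Proof.
have [F FT mF] : sigma_finite setT (lebesgue_measure \x mu)%E.
  have [F FT mF] := sigma_finiteT (@lebesgue_measure R).
  have [G GT mG] := sigma_finiteT mu.
  pose dec k := odflt (0, 0)%N (unpickle k : option (nat * nat)).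
  exists (fun k => F (dec k).1 `*` G (dec k).2).
    apply/seteqP; split=> // -[x y] _ /=.
    have [i _ Fix] : (\bigcup_i F i) x by rewrite -FT.
    have [j _ Gjy] : (\bigcup_j G j) y by rewrite -GT.
    by exists (pickle (i, j)) => //=; rewrite /dec pickleK.
  move=> k; have [mFk Fk] := mF (dec k).1; have [mGk Gk] := mG (dec k).2.
  split; first exact: measurableX.
  by rewrite product_measure1E// lte_mul_pinfty// ge0_fin_numE.
pose g (x : 'rV[R]_n.+1) : measurableTypeR R * 'rV[R]_n :=
  ((x : 'rV[R]_(1 + n)) 0 (lshift n 0), rsubmx (x : 'rV[R]_(1 + n))).
have mg : measurable_fun setT g.
  apply: measurable_fun_pair => /=; first exact: measurable_coord.
  apply: measurable_fun_rV => i; rewrite (_ : (fun x => _) =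
    fun x : 'rV[R]_n.+1 => x 0 (rshift 1 i)); first exact: measurable_coord.
  by apply/funext => x; rewrite mxE.
have gK : cancel (@row_cons n) g.
  by move=> [a v]; rewrite /g /row_cons row_mxEl mxE eqxx mulr1n row_mxKr.
exists (fun i => g @^-1` F i).
  by rewrite -preimage_bigcup -FT preimage_setT.
move=> i; split; first by rewrite -[X in measurable X]setTI; apply: mg => //;
  case: (mF i).
rewrite /lebesgue_rV_succ /pushforward -comp_preimage.
rewrite (_ : g \o _ = id); first by case: (mF i).
by apply/funext => p /=; rewrite gK.
Qed.

HB.instance Definition _ := Measure_isSigmaFinite.Build _ _ _
  lebesgue_rV_succ lebesgue_rV_succ_sigma_finite.

End step.

(* The n-fold product of the Lebesgue measure of R. *)
Fixpoint lebesgue_rV (n : nat) :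
    {sigma_finite_measure set 'rV[R]_n -> \bar R} :=
  match n with
  | 0 => dirac (0 : 'rV[R]_0)
  | m.+1 => lebesgue_rV_succ (lebesgue_rV m)
  end.

End lebesgue_rV.

Definition sphere (R : realType) (n : nat) : set 'rV[R]_n :=
  [set x | enorm x = 1].

Section sphere_measure.
Variables (R : realType) (n : nat).

Definition normalize (x : 'rV[R]_n) : 'rV[R]_n := (enorm x)^-1 *: x.

(* The surface measure on the sphere, as a measure on the ambient space: the
   surface measure of A is n times the volume of the cone
   { t *: theta | theta in A, 0 < t <= 1 }, this cone being the set of the
   nonzero x of the closed unit ball such that normalize x is in A. *)
Definition sphere_measure (A : set 'rV[R]_n) : \bar R :=
  (n%:R%:E * lebesgue_rV R n
     ([set x | (0 < enorm x <= 1)%R] `&` normalize @^-1` A))%E.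

Lemma measurable_enorm : measurable_fun setT (@enorm R n).
Proof.
have -> : @enorm R n = (fun r => r `^ 2^-1) \o
    (fun x : 'rV[R]_n => \sum_(i < n) x 0 i ^+ 2).
  apply/funext => x /=; rewrite powR12_sqrt//.
  by apply: sumr_ge0 => i _; exact: sqr_ge0.
apply: measurableT_comp; first exact: measurable_powR.
by apply: measurable_sum => i; apply: measurable_funX; exact: measurable_coord.
Qed.

Lemma measurable_normalize : measurable_fun setT normalize.
Proof.
apply: measurable_fun_rV => i.
have -> : (fun x => normalize x 0 i) =
    (fun x => ((fun r => r `^ (-1)) \o @enorm R n) x * x 0 i).
  by apply/funext => x /=; rewrite mxE powR_inv1// sqrtr_ge0.
apply: measurable_funM; last exact: measurable_coord.
apply: measurableT_comp; first exact: measurable_powR.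
exact: measurable_enorm.
Qed.

Let measurable_punctured_ball :
  measurable [set x : 'rV[R]_n | 0 < enorm x <= 1].
Proof.
rewrite (_ : [set _ | _] = @enorm R n @^-1` `]0, 1]%classic); last first.
  by apply/seteqP; split => x /=; rewrite in_itv.
by rewrite -[X in measurable X]setTI; exact: measurable_enorm.
Qed.

Let sphere_measure0 : sphere_measure set0 = 0%E.
Proof. by rewrite /sphere_measure preimage_set0 setI0 measure0 mule0. Qed.

Let sphere_measure_ge0 A : (0 <= sphere_measure A)%E.
Proof. by rewrite /sphere_measure mule_ge0// lee_fin. Qed.

Let pm := mscale (n%:R)%:nng
  [the {measure set _ -> \bar R} of
   mrestr (lebesgue_rV R n) measurable_punctured_ball].

Let sphere_measure_sigma_additive : semi_sigma_additive sphere_measure.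
Proof.
move=> F mF tF mUF.
have mN A : measurable A -> measurable (normalize @^-1` A).
  by move=> mA; rewrite -[X in measurable X]setTI; exact: measurable_normalize.
have pmE A : sphere_measure A = pm (normalize @^-1` A).
  by rewrite /sphere_measure /pm /mscale /mrestr /= setIC.
rewrite pmE preimage_bigcup; under eq_fun do under eq_bigr do rewrite pmE.
apply: measure_semi_sigma_additive.
- by move=> i; exact: mN.
- apply/trivIsetP => /= i j _ _ ij; rewrite -preimage_setI.
  by move/trivIsetP : tF => /(_ _ _ _ _ ij) ->//; rewrite preimage_set0.
- by rewrite -preimage_bigcup; exact: mN.
Qed.

HB.instance Definition _ := isMeasure.Build _ _ _ sphere_measure
  sphere_measure0 sphere_measure_ge0 sphere_measure_sigma_additive.

End sphere_measure.

Definition dual_volume (R : realType) (n i : nat) (K : set 'rV[R]_n) : \bar R :=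
  (n%:R^-1%:E * \int[@sphere_measure R n]_(theta in @sphere R n)
                  (radial K theta ^+ i)%:E)%E.

(* Main.v *)
Require Import Defs.
From mathcomp Require Import all_boot all_order all_algebra.
From mathcomp Require Import all_classical all_reals all_analysis.
From mathcomp Require Import measurable_realfun.
From mathcomp Require Import ring.
From mathcomp Require Import perm.

(** Let E be the ellipsoid with semi-axes a_k, written E = {g <= 1} where g is
    homogeneous of degree 1 and g^2 is a quadratic form. Its radial function on
    the sphere is 1/g, so that n V_i(E) is the integral of g^(-i) over the sphere.
    The top one, V_n(E), is the volume of E, and thus determines the product of
    the semi-axes ([volume_of_dual_volume], [ellipsoid_volume]).

    For the other ones, look at the family of auxiliary ellipsoids
    S_u = {|x|^2 + u^2 g(x)^2 <= 1}, for u > 0. On the one hand, the volume of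
    S_u is that of the unit ball times prod_k a_k (u^2 + a_k^2)^(-1/2)
    ([ellipsoid_ball_volume]). On the other hand, polar coordinates write it as
    an integral over the sphere of a fixed function of u g(theta)
    ([volume_ball_gauge]); integrating against u^i du/u, and substituting
    v = u g(theta), gives a constant, depending on n and i only, times the
    integral of g^(-i), that is, times V_i(E) ([haar_dual_volume]). The integrals
    converge for 1 <= i < n. So, for two ellipsoids with the same dual volumes,
    the functions P(u^2)^(-1/2) and Q(u^2)^(-1/2) have the same integrals
    against 1, u, ..., u^(n-2) on the half-line, where
    P = prod_k (X + a_k^2), Q = prod_k (X + b_k^2), and P(0) = Q(0).

    This forces P = Q ([decay_moments_inj]). Otherwise P - Q = X S with S of
    degree at most n - 2, both polynomials being monic of degree n. Each positive
    root r of S contributes a sign change of P(u^2) - Q(u^2) at u = sqrt r;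
    multiplying these factors u - sqrt r gives a polynomial q of degree at most
    n - 2 such that q(u) S(u^2) >= 0 for all u > 0 ([poly_sign_companion]). Then
    q(u) (Q(u^2)^(-1/2) - P(u^2)^(-1/2)) is nonnegative, has integral 0 and
    only finitely many zeros, a contradiction. From P = Q the semi-axes agree up
    to a permutation, and the ellipsoids are congruent.

    The measure theory rests on scaling and Tonelli. Rotation invariance of the
    Lebesgue measure comes from the usual proof that Haar measures are unique
    ([lebesgue_rV_linear]). Polar coordinates ([polar_coordinates]) follow from
    the invariance of dr/r under scaling, with a finite
    positive constant, which then cancels out. *)

Set Implicit Arguments.
Unset Strict Implicit.
Unset Printing Implicit Defensive.

Import Order.TTheory GRing.Theory Num.Theory.
Import numFieldNormedType.Exports.

Local Open Scope classical_set_scope.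
Local Open Scope ring_scope.

(** * Measurability and Tonelli on subsets *)

Lemma measurable_preimageT d d' (T : measurableType d) (U : measurableType d')
    (f : T -> U) (A : set U) :
  measurable_fun setT f -> measurable A -> measurable (f @^-1` A).
Proof. by move=> mf mA; rewrite -[X in measurable X]setTI; exact: mf. Qed.

(** The inverse of 0 is 0, so that x^-1 = x (x^2)^-1 everywhere, and on nonnegative
    reals the inverse is a real power, known to be measurable. *)
Lemma measurable_invr_fun d (T : measurableType d) (R : realType) (f : T -> R) :
  measurable_fun setT f -> measurable_fun setT (fun x => (f x)^-1).
Proof.
move=> mf; rewrite (_ : (fun x => _) = (fun x => f x * (f x ^+ 2) `^ (-1))).
  apply: measurable_funM => //.
  apply: (measurableT_comp (measurable_powR (-1))) => /=.
  exact: measurable_funX.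
apply/funext => x; rewrite powR_inv1 ?sqr_ge0// expr2.
have [->|fx0] := eqVneq (f x) 0; first by rewrite invr0 mul0r.
by rewrite invfM mulrA divff// mul1r.
Qed.

Lemma measurable_sqrt_fun d (T : measurableType d) (R : realType) (f : T -> R) :
  measurable_fun setT f -> measurable_fun setT (fun x => Num.sqrt (f x)).
Proof.
move=> mf; apply: (measurableT_comp _ mf).
by apply: nondecreasing_measurable => // x y; exact: ler_wsqrtr.
Qed.

Lemma measurable_set_le d (T : measurableType d) (R : realType) (f g : T -> R) :
  measurable_fun setT f -> measurable_fun setT g ->
  measurable [set x | f x <= g x].
Proof.
move=> mf mg; have mb := measurable_fun_ler mf mg.
rewrite (_ : [set _ | _] = (fun x => f x <= g x) @^-1` [set true]).
  exact: measurable_preimageT.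
by apply/seteqP; split => x /=.
Qed.

Lemma measurable_set_lt d (T : measurableType d) (R : realType) (f g : T -> R) :
  measurable_fun setT f -> measurable_fun setT g ->
  measurable [set x | f x < g x].
Proof.
move=> mf mg; have mb := measurable_fun_ltr mf mg.
rewrite (_ : [set _ | _] = (fun x => f x < g x) @^-1` [set true]).
  exact: measurable_preimageT.
by apply/seteqP; split => x /=.
Qed.

Lemma measurable_EFin_le d (T : measurableType d) (R : realType) (f g : T -> R) :
  measurable_fun setT f -> measurable_fun setT g ->
  measurable_fun setT (fun x => ((f x <= g x)%R%:R)%:E : \bar R).
Proof.
move=> mf mg.
rewrite (_ : (fun _ => _) = EFin \o \1_[set x | f x <= g x]).
  by apply/measurable_EFinP; apply: measurable_indic; exact: measurable_set_le.
apply/funext => x /=; rewrite indicE; congr (nat_of_bool _)%:R%:E.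
by apply/idP/idP; rewrite inE.
Qed.

Lemma integral_EFin_le d (T : measurableType d) (R : realType)
    (mu : {measure set T -> \bar R}) (f g : T -> R) :
  measurable_fun setT f -> measurable_fun setT g ->
  (\int[mu]_x ((f x <= g x)%R%:R)%:E = mu [set x | f x <= g x]%R)%E.
Proof.
move=> mf mg; rewrite -[X in mu X]setIT -integral_indic//; last first.
  exact: measurable_set_le.
apply: eq_integral => x _; rewrite indicE; congr (nat_of_bool _)%:R%:E.
by apply/idP/idP; rewrite inE.
Qed.

(** Both sides are measures on the product which agree on rectangles. *)
Lemma product_measureC d1 d2 (T1 : measurableType d1) (T2 : measurableType d2)
    (R : realType) (m1 : {sigma_finite_measure set T1 -> \bar R})
    (m2 : {sigma_finite_measure set T2 -> \bar R}) (X : set (T1 * T2)) :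
  measurable X ->
  (\int[m1]_x m2 (xsection X x) = \int[m2]_y m1 (ysection X y))%E.
Proof.
move=> mX; rewrite -[LHS]/((m1 \x m2)%E X) -[RHS]/((m1 \x^ m2)%E X).
by apply: product_measure_unique => // A B mA mB; exact: product_measure2E.
Qed.

Section tonelli_on.
Context d1 d2 (T1 : measurableType d1) (T2 : measurableType d2) (R : realType).
Variables (m1 : {sigma_finite_measure set T1 -> \bar R})
  (m2 : {sigma_finite_measure set T2 -> \bar R}).
Variables (D1 : set T1) (D2 : set T2) (f : T1 -> T2 -> \bar R).
Hypotheses (mD1 : measurable D1) (mD2 : measurable D2).
Hypothesis mf : measurable_fun setT (fun p : T1 * T2 => f p.1 p.2).
Hypothesis f0 : forall x y, D1 x -> D2 y -> (0 <= f x y)%E.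

Let g := (fun p : T1 * T2 => f p.1 p.2) \_ (D1 `*` D2).

Let mg : measurable_fun setT g.
Proof.
apply/(measurable_restrictT _ (measurableX mD1 mD2)).
exact: measurable_funTS.
Qed.

Let g0 p : (0 <= g p)%E.
Proof.
by rewrite /g patchE; case: ifPn => // /set_mem[]; exact: f0.
Qed.

Let intE1 : (fun x => \int[m2]_y g (x, y))%E =
  (fun x => \int[m2]_(y in D2) f x y)%E \_ D1.
Proof.
apply/funext => x; rewrite patchE; case: ifPn => Dx.
  rewrite [RHS]integral_mkcond; apply: eq_integral => y _.
  by rewrite /g !patchE in_setX Dx.
by apply: integral0_eq => y _; rewrite /g !patchE in_setX (negbTE Dx).
Qed.

Let intE2 : (fun y => \int[m1]_x g (x, y))%E =
  (fun y => \int[m1]_(x in D1) f x y)%E \_ D2.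
Proof.
apply/funext => y; rewrite patchE; case: ifPn => Dy.
  rewrite [RHS]integral_mkcond; apply: eq_integral => x _.
  by rewrite /g !patchE in_setX Dy andbT.
by apply: integral0_eq => x _; rewrite /g !patchE in_setX (negbTE Dy) andbF.
Qed.

(** Tonelli's theorem applied to the function extended by 0 outside D1 x D2. *)
Lemma tonelli_on : (\int[m1]_(x in D1) \int[m2]_(y in D2) f x y =
  \int[m2]_(y in D2) \int[m1]_(x in D1) f x y)%E.
Proof.
by rewrite [LHS]integral_mkcond [RHS]integral_mkcond -intE1 -intE2 fubini_tonelli.
Qed.

Lemma measurable_integral_on :
  measurable_fun D1 (fun x => \int[m2]_(y in D2) f x y)%E.
Proof.
apply/measurable_restrictT => //; rewrite -intE1.
exact: (measurable_fun_fubini_tonelli_F g).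
Qed.

End tonelli_on.

(** The measure structure of a pushforward depends on a proof that the map is
    measurable, which unification cannot find; here it is an explicit argument. *)
Definition image_measure d d' (T1 : measurableType d) (T2 : measurableType d')
    (R : realType) (m : {measure set T1 -> \bar R}) (f : T1 -> T2)
    (mf : measurable_fun setT f) : {measure set T2 -> \bar R} :=
  measure_function_pushforward__canonical__measure_function_Measure m mf.

(** The change of variables behind every substitution below: only the measure of
    the preimages has to be known, and only for subsets of D, which is what allows
    to treat the surface measure of the sphere, where f maps part of the space
    outside D. *)
Lemma ge0_integral_image d1 d2 (T1 : measurableType d1) (T2 : measurableType d2)
    (R : realType) (m1 : {measure set T1 -> \bar R})
    (m2 : {measure set T2 -> \bar R}) (c : R) (f : T1 -> T2) (D : set T2)
    (g : T2 -> \bar R) : 0 <= c ->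
  measurable_fun setT f ->
  (forall A, measurable A -> A `<=` D -> m2 A = c%:E * m1 (f @^-1` A))%E ->
  measurable D -> measurable_fun D g -> (forall y, D y -> 0 <= g y)%E ->
  (\int[m2]_(y in D) g y = c%:E * \int[m1]_(x in f @^-1` D) g (f x))%E.
Proof.
move=> c0 mf m2E mD mg g0.
rewrite (eq_measure_integral (mscale (NngNum c0) (image_measure m1 mf))).
  rewrite ge0_integral_mscale//; congr (_ * _)%E.
  by apply: ge0_integral_pushforward => // y /set_mem; exact: g0.
by move=> A mA AD; exact: m2E.
Qed.

(** * Affine and linear images of Lebesgue measure *)

Lemma lebesgue_measure_affine (R : realType) (s t : R)
    (A : set (measurableTypeR R)) : 0 < s -> measurable A ->
  lebesgue_measure A =
  (s%:E * lebesgue_measure ((fun x : R => (s * x + t)%R) @^-1` A))%E.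
Proof.
move=> s0 mA.
pose f (x : measurableTypeR R) : measurableTypeR R := s * x + t.
have mf : measurable_fun setT f by apply: measurable_funD => //; exact: measurable_funM.
suff E X : ocitv X -> lebesgue_measure X =
    mscale (NngNum (ltW s0)) (image_measure lebesgue_measure mf) X.
  exact: (lebesgue_measure_unique E).
move=> [[a b] _ <-]; rewrite /mscale /= /pushforward/=.
have -> : f @^-1` `]a, b] = `](a - t) / s, (b - t) / s]%classic.
  apply/seteqP; split => x /=; rewrite !in_itv/= /f ltr_pdivrMr// ler_pdivlMr//;
    by rewrite ltrBlDr lerBrDr (mulrC x).
rewrite !lebesgue_measure_itv/= !lte_fin ltr_pM2r ?invr_gt0// ltrD2r.
case: ifPn => _; last by rewrite mule0.
by rewrite -!EFinB -EFinM; congr EFin; field; rewrite gt_eqF.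
Qed.

Lemma row_cons0 (R : realType) n (p : measurableTypeR R * 'rV[R]_n) :
  row_cons p 0 ord0 = p.1.
Proof.
have -> : ord0 = lshift n (0 : 'I_1) by exact/val_inj.
by apply: etrans (row_mxEl _ _ _ _) _; rewrite mxE.
Qed.

Lemma row_consS (R : realType) n (p : measurableTypeR R * 'rV[R]_n) i :
  row_cons p 0 (lift ord0 i) = p.2 0 i.
Proof.
have -> : lift ord0 i = rshift 1 i by exact/val_inj.
exact: row_mxEr.
Qed.

Definition diag_affine (R : realType) n (s : 'I_n -> R) (t x : 'rV[R]_n) :
  'rV[R]_n := \row_i (s i * x 0 i + t 0 i).

Lemma measurable_diag_affine (R : realType) n (s : 'I_n -> R) (t : 'rV[R]_n) :
  measurable_fun setT (diag_affine s t).
Proof.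
apply: measurable_fun_rV => i; under eq_fun do rewrite mxE.
apply: measurable_funD => //; apply: measurable_funM => //.
exact: measurable_coord.
Qed.

(** By induction on the dimension: the affine map acts on each coordinate
    separately, so that the pushed and rescaled product measure agrees with the
    product measure on rectangles. *)
Lemma lebesgue_rV_affine (R : realType) n (s : 'I_n -> R) (t : 'rV[R]_n)
    (A : set 'rV[R]_n) : (forall i, 0 < s i) -> measurable A ->
  lebesgue_rV R n A =
  ((\prod_i s i)%:E * lebesgue_rV R n (diag_affine s t @^-1` A))%E.
Proof.
elim: n s t A => [|n IHn] s t A s0 mA.
  rewrite big_ord0 mul1e; congr (lebesgue_rV R 0 _).
  by apply/seteqP; split => x /=; rewrite (thinmx0 (diag_affine s t x)) (thinmx0 x).
pose s' i := s (lift ord0 i); pose t' : 'rV[R]_n := \row_i t 0 (lift ord0 i).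
pose f (p : measurableTypeR R * 'rV[R]_n) : measurableTypeR R * 'rV[R]_n :=
  (s ord0 * p.1 + t 0 ord0, diag_affine s' t' p.2).
have mf : measurable_fun setT f.
  apply: measurable_fun_pair => /=.
    by apply: measurable_funD => //; exact: measurable_funM.
  by apply: measurableT_comp => //; exact: measurable_diag_affine.
have fE p : diag_affine s t (row_cons p) = row_cons (f p).
  apply/rowP => i; case: (unliftP ord0 i) => [j ->|->].
    by rewrite !(mxE, row_consS).
  by rewrite !(mxE, row_cons0).
have ps0 : 0 <= \prod_i s i by apply: prodr_ge0 => i _; exact: ltW.
have E X : measurable X -> (lebesgue_measure \x lebesgue_rV R n)%E X =
    mscale (NngNum ps0) (image_measure (lebesgue_measure \x lebesgue_rV R n)%E mf) X.
  apply: product_measure_unique => B C mB mC.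
  transitivity ((\prod_i s i)%:E *
    (lebesgue_measure \x lebesgue_rV R n) (f @^-1` (B `*` C)))%E; first by [].
  rewrite big_ord_recl EFinM.
  have -> : f @^-1` (B `*` C) = ((fun x => s ord0 * x + t 0 ord0) @^-1` B) `*`
      (diag_affine s' t' @^-1` C) by [].
  rewrite product_measure1E; last 2 first.
  - apply: measurable_preimageT => //.
    by apply: measurable_funD => //; exact: measurable_funM.
  - by apply: measurable_preimageT => //; exact: measurable_diag_affine.
  by rewrite muleACA -(lebesgue_measure_affine _ (s0 _))// -IHn// => i; exact: s0.
rewrite /= /lebesgue_rV_succ /pushforward E; last first.
  by apply: measurable_preimageT => //; exact: measurable_row_cons.
rewrite /mscale/= /pushforward; congr (_ * (_ \x _) _)%E.
by apply/seteqP; split => p /=; rewrite fE.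
Qed.

Lemma lebesgue_rV_translate (R : realType) n (t : 'rV[R]_n) (A : set 'rV[R]_n) :
  measurable A -> lebesgue_rV R n ((fun x => x + t) @^-1` A) = lebesgue_rV R n A.
Proof.
move=> mA; rewrite [RHS](@lebesgue_rV_affine _ _ (fun=> 1) t)// big1_eq mul1e.
congr (lebesgue_rV R n _); apply/seteqP.
by split => x /=; rewrite (_ : diag_affine _ _ _ = x + t)//;
  apply/rowP => i; rewrite !mxE mul1r.
Qed.

Lemma measurable_mulmxr (R : realType) m n (M : 'M[R]_(m, n)) :
  measurable_fun setT (fun x : 'rV[R]_m => x *m M).
Proof.
apply: measurable_fun_rV => i; under eq_fun do rewrite mxE.
apply: measurable_sum => j; apply: measurable_funM => //.
exact: measurable_coord.
Qed.

Lemma measurable_addrV d (T : measurableType d) (R : realType) n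
    (f g : T -> 'rV[R]_n) : measurable_fun setT f -> measurable_fun setT g ->
  measurable_fun setT (fun x => f x + g x).
Proof.
move=> mf mg; apply: measurable_fun_rV => i; under eq_fun do rewrite mxE.
apply: measurable_funD.
  exact: (measurableT_comp (measurable_coord i) mf).
exact: (measurableT_comp (measurable_coord i) mg).
Qed.

Lemma measurable_opprV d (T : measurableType d) (R : realType) n
    (f : T -> 'rV[R]_n) : measurable_fun setT f ->
  measurable_fun setT (fun x => - f x).
Proof.
move=> mf; apply: measurable_fun_rV => i; under eq_fun do rewrite mxE.
by apply: measurableT_comp => //; exact: (measurableT_comp (measurable_coord i) mf).
Qed.

(** Uniqueness of translation-invariant measures, for the measure nu and its image
    by M. Integrate over (x, y) the indicator of [x M + y in A and y in B].
    Integrating in x first gives the left-hand side, by translation invariance.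
    Translating y by x M turns the condition into [y in A and y - x M in B];
    integrating in x first again gives the right-hand side, B being symmetric. *)
Lemma lebesgue_rV_linear (R : realType) n (M : 'M[R]_n) (A B : set 'rV[R]_n) :
  M \in unitmx -> measurable A -> measurable B -> (forall x, B x -> B (- x)) ->
  (lebesgue_rV R n ((fun x => x *m M) @^-1` A) * lebesgue_rV R n B =
   lebesgue_rV R n A * lebesgue_rV R n ((fun x => x *m M) @^-1` B))%E.
Proof.
move=> uM mA mB symB; set nu := lebesgue_rV R n; set f := fun x => x *m M.
have mf : measurable_fun setT f by exact: measurable_mulmxr.
pose T := ('rV[R]_n * 'rV[R]_n)%type.
have mf1 : measurable_fun setT (fun p : T => f p.1) by exact: measurableT_comp.
pose g1 (p : T) := p.2 + f p.1; pose g2 (p : T) := p.2 - f p.1.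
(* the two forms of the domain of integration, before and after translating y *)
pose S1 := g1 @^-1` A `&` snd @^-1` B; pose S2 := snd @^-1` A `&` g2 @^-1` B.
have mS1 : measurable S1.
  apply: measurableI; last exact: (measurable_preimageT measurable_snd).
  apply: measurable_preimageT mA.
  exact: measurable_addrV.
have mS2 : measurable S2.
  apply: measurableI; first exact: (measurable_preimageT measurable_snd).
  apply: measurable_preimageT mB.
  by apply: measurable_addrV => //; exact: measurable_opprV.
have indicZ (c : \bar R) (D : set 'rV[R]_n) : (0 <= c)%E -> measurable D ->
    (\int[nu]_y (c * (\1_D y)%:E) = c * nu D)%E.
  move=> c0 mD; rewrite ge0_integralZl//.
  - by rewrite integral_indic// setIT.
  - by apply/measurable_EFinP; exact: measurable_indic.
transitivity (\int[nu]_x nu (xsection S1 x))%E.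
  rewrite product_measureC// -indicZ//; apply: eq_integral => y _.
  rewrite indicE; case: (pselect (B y)) => By.
    rewrite mem_set// mule1 -(lebesgue_rV_translate (y *m invmx M));
      last exact: measurable_preimageT.
    congr (nu _); apply/seteqP; split => x;
      rewrite /ysection /= inE /S1 /g1 /f/= mulmxDl mulmxKV// addrC//.
    by case.
  rewrite memNset// mule0 (_ : ysection _ _ = set0) ?measure0//.
  by rewrite -subset0 => x; rewrite /ysection /= inE => -[].
transitivity (\int[nu]_x nu (xsection S2 x))%E.
  apply: eq_integral => x _.
  rewrite -[RHS](lebesgue_rV_translate (f x)); last exact: measurable_xsection.
  congr (nu _); apply/seteqP.
  by split => y; rewrite /xsection /= !inE /S1 /S2 /g1 /g2/= addrK.
rewrite product_measureC// muleC -indicZ//; apply: eq_integral => y _.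
rewrite indicE; case: (pselect (A y)) => Ay.
  rewrite mem_set// mule1 -[RHS](lebesgue_rV_translate (- (y *m invmx M)));
    last exact: measurable_preimageT.
  congr (nu _); apply/seteqP; split => x;
    rewrite /ysection /= inE /S2 /g2 /f/= mulmxBl mulmxKV//.
    by move=> [_ /symB]; rewrite opprB.
  by move=> /symB; rewrite opprB.
rewrite memNset// mule0 (_ : ysection _ _ = set0) ?measure0//.
by rewrite -subset0 => x; rewrite /ysection /= inE => -[].
Qed.

(** * Euclidean balls and the volume of ellipsoids *)

Lemma enorm_sqr (R : realType) n (x : 'rV[R]_n) :
  enorm x ^+ 2 = \sum_(i < n) x 0 i ^+ 2.
Proof. by rewrite sqr_sqrtr// sumr_ge0// => i _; exact: sqr_ge0. Qed.

Lemma enorm_ge0 (R : realType) n (x : 'rV[R]_n) : 0 <= enorm x.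
Proof. exact: sqrtr_ge0. Qed.

Lemma enormZ (R : realType) n (a : R) (x : 'rV[R]_n) :
  enorm (a *: x) = `|a| * enorm x.
Proof.
rewrite /enorm -sqrtr_sqr -sqrtrM ?sqr_ge0//; congr Num.sqrt.
by rewrite mulr_sumr; apply: eq_bigr => i _; rewrite mxE exprMn.
Qed.

Lemma enormN (R : realType) n (x : 'rV[R]_n) : enorm (- x) = enorm x.
Proof. by rewrite -scaleN1r enormZ normrN1 mul1r. Qed.

Lemma enorm0 (R : realType) n : enorm (0 : 'rV[R]_n) = 0.
Proof. by rewrite -(scale0r 0) enormZ normr0 mul0r. Qed.

Lemma enorm_gt0 (R : realType) n (x : 'rV[R]_n) : (0 < enorm x) = (x != 0).
Proof.
rewrite lt_def enorm_ge0 andbT; congr negb; apply/eqP/eqP => [x0|->]; last first.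
  exact: enorm0.
apply/rowP => i; rewrite mxE; apply/eqP; rewrite -sqrf_eq0.
have := enorm_sqr x; rewrite x0 expr0n/= => /esym/eqP.
by rewrite psumr_eq0 => [/allP/(_ i (mem_index_enum i))//|j _]; exact: sqr_ge0.
Qed.

Lemma enorm_mulmx (R : realType) n (U : 'M[R]_n) (x : 'rV[R]_n) :
  orthogonal_mx U -> enorm (x *m U) = enorm x.
Proof.
have dot (y : 'rV[R]_n) : \sum_i y 0 i ^+ 2 = (y *m y^T) 0 0.
  by rewrite mxE; apply: eq_bigr => i _; rewrite mxE expr2.
by move=> UU; rewrite /enorm !dot trmx_mul mulmxA -(mulmxA x) UU mulmx1.
Qed.

Lemma orthogonal_mxT (R : realType) n (U : 'M[R]_n) :
  orthogonal_mx U -> orthogonal_mx U^T.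
Proof. by move=> /mulmx1C; rewrite /orthogonal_mx trmxK. Qed.

Definition unit_ball (R : realType) n : set 'rV[R]_n := [set x | enorm x <= 1].

Arguments unit_ball : clear implicits.

Lemma measurable_unit_ball (R : realType) n : measurable (unit_ball R n).
Proof.
rewrite (_ : unit_ball R n = @enorm R n @^-1` `]-oo, 1]%classic).
  by apply: measurable_preimageT; [exact: measurable_enorm|exact: measurable_itv].
by apply/seteqP; split => x; rewrite /unit_ball/= in_itv.
Qed.

(** The volume of a cube serves to bound that of the ball from both sides. *)
Lemma lebesgue_rV_cube (R : realType) n (c : R) : 0 < c ->
  measurable [set x : 'rV[R]_n | forall i, `|x 0 i| <= c] /\
  lebesgue_rV R n [set x | forall i, `|x 0 i| <= c] = ((c *+ 2) ^+ n)%:E.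
Proof.
move=> c0.
have mcube m : measurable [set x : 'rV[R]_m | forall i, `|x 0 i| <= c].
  rewrite (_ : [set _ | _] =
      \bigcap_(i in setT) ((fun x : 'rV[R]_m => x 0 i) @^-1` `[- c, c]%classic)).
    apply: fin_bigcap_measurable => // i _.
    by apply: measurable_preimageT; [exact: measurable_coord|exact: measurable_itv].
  apply/seteqP; split => x /= xc i.
    by move=> _; rewrite /= in_itv/= -ler_norml.
  by have := xc i I; rewrite /= in_itv/= -ler_norml.
split => //; elim: n => [|n IHn].
  by rewrite /= diracE mem_set// => -[].
transitivity ((lebesgue_measure \x lebesgue_rV R n)%E
    (`[- c, c]%classic `*` [set x : 'rV[R]_n | forall i, `|x 0 i| <= c])); last first.
  rewrite product_measure1E//; last exact: mcube.
  rewrite exprS EFinM; congr (_ * _)%E; last exact: IHn.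
  by rewrite [LHS]lebesgue_measure_itv/= lte_fin gtrN// -EFinB opprK.
apply: (congr1 (lebesgue_measure \x lebesgue_rV R n)%E).
apply/seteqP; split => -[a x] /=; rewrite in_itv/= -ler_norml.
  move=> xc; split; first by have := xc ord0; rewrite row_cons0.
  by move=> i; have := xc (lift ord0 i); rewrite row_consS.
move=> [ac xc] i; case: (unliftP ord0 i) => [j ->|->].
  by rewrite row_consS.
by rewrite row_cons0.
Qed.

Lemma lebesgue_rV_ball_fin_num (R : realType) n :
  lebesgue_rV R n (unit_ball R n) \is a fin_num.
Proof.
have [mC eC] := lebesgue_rV_cube n (@ltr01 R).
rewrite ge0_fin_numE//; apply: (@le_lt_trans _ _ ((1 *+ 2) ^+ n)%:E); last exact: ltry.
rewrite -eC le_measure ?inE//; first exact: measurable_unit_ball.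
move=> x /= x1 i; rewrite -(@ler_pXn2r _ 2)// ?nnegrE// expr1n real_normK ?num_real//.
apply: (@le_trans _ _ (enorm x ^+ 2)); last by rewrite expr_le1// enorm_ge0.
by rewrite enorm_sqr (bigD1 i)//= lerDl sumr_ge0// => j _; exact: sqr_ge0.
Qed.

(** The ball contains the cube of half-side 1/(n+1), as n/(n+1)^2 <= 1. *)
Lemma lebesgue_rV_ball_gt0 (R : realType) n :
  (0 < lebesgue_rV R n (unit_ball R n))%E.
Proof.
pose c : R := n.+1%:R^-1; have c0 : 0 < c by rewrite invr_gt0.
have [mC eC] := lebesgue_rV_cube n c0.
apply: (@lt_le_trans _ _ ((c *+ 2) ^+ n)%:E).
  by rewrite lte_fin exprn_gt0// pmulrn_rgt0.
rewrite -eC le_measure ?inE//; first exact: measurable_unit_ball.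
move=> x /= xc; rewrite /unit_ball/= -(@ler_pXn2r _ 2)// ?nnegrE ?enorm_ge0//.
rewrite expr1n enorm_sqr; apply: (@le_trans _ _ (\sum_(i < n) c)).
  apply: ler_sum => i _; rewrite -real_normK ?num_real//.
  rewrite (le_trans (_ : _ <= c ^+ 2))//; first by rewrite ler_pXn2r// nnegrE ltW.
  by rewrite expr2 ger_pMl// invf_le1 ?ltr0n// ler1n.
by rewrite sumr_const card_ord -[leLHS]mulr_natl ler_pdivrMr// mul1r ler_nat.
Qed.

(** The unit ball is invariant under U, symmetric, and has finite positive volume:
    taking it as B in [lebesgue_rV_linear] gives the result. *)
Lemma lebesgue_rV_orthogonal (R : realType) n (U : 'M[R]_n) (A : set 'rV[R]_n) :
  orthogonal_mx U -> measurable A ->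
  lebesgue_rV R n ((fun x => x *m U) @^-1` A) = lebesgue_rV R n A.
Proof.
move=> oU mA; have [uU _] := mulmx1_unit oU.
have := lebesgue_rV_linear uU mA (@measurable_unit_ball R n).
rewrite (_ : _ @^-1` unit_ball R n = unit_ball R n); last first.
  by apply/seteqP; split => x; rewrite /unit_ball/= enorm_mulmx.
have B0 := lebesgue_rV_ball_gt0 R n; have Bfin := lebesgue_rV_ball_fin_num R n.
have symB x : unit_ball R n x -> unit_ball R n (- x) by rewrite /unit_ball/= enormN.
move=> /(_ symB)/(congr1 (fun y => y / lebesgue_rV R n (unit_ball R n)))%E.
by rewrite -!muleA divee ?mule1// gt_eqF.
Qed.

Lemma lebesgue_rV_ellipsoid (R : realType) n (U : 'M[R]_n) (s : 'I_n -> R) :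
  orthogonal_mx U -> (forall i, 0 < s i) ->
  lebesgue_rV R n (unit_ball R n) = ((\prod_i s i)%:E *
    lebesgue_rV R n [set x | (\sum_i (s i * (x *m U) 0 i) ^+ 2 <= 1)%R])%E.
Proof.
move=> oU s0; rewrite (lebesgue_rV_affine 0 s0); last exact: measurable_unit_ball.
rewrite -(lebesgue_rV_orthogonal oU); last first.
  apply: measurable_preimageT; first exact: measurable_diag_affine.
  exact: measurable_unit_ball.
congr (_ * lebesgue_rV R n _)%E; apply/seteqP.
suff E x : unit_ball R n (diag_affine s 0 (x *m U)) =
    (\sum_i (s i * (x *m U) 0 i) ^+ 2 <= 1) by split => x /=; rewrite E.
rewrite /unit_ball/= -(@ler_pXn2r _ 2)// ?nnegrE ?enorm_ge0// expr1n enorm_sqr.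
congr (_ <= _); apply: eq_bigr => i _.
by rewrite [diag_affine _ _ _ _ _]mxE [X in _ + X]mxE addr0.
Qed.

Lemma lebesgue_rV_scale (R : realType) n (s : R) (A : set 'rV[R]_n) : 0 < s ->
  measurable A ->
  lebesgue_rV R n A = ((s ^+ n)%:E * lebesgue_rV R n ((fun x => s *: x) @^-1` A))%E.
Proof.
move=> s0 mA; rewrite (@lebesgue_rV_affine _ _ (fun=> s) 0)// prodr_const card_ord.
congr (_ * lebesgue_rV R n _)%E; apply/seteqP.
by split => x /=; rewrite (_ : diag_affine _ _ _ = s *: x)//; apply/rowP => i;
  rewrite !mxE addr0.
Qed.

(** * Integration against the scale-invariant measure of the half-line *)

Local Notation halfline R := (`]0%R, +oo[%classic : set (measurableTypeR R)).

(** The integral for the measure dr/r. With this measure the scalings of polar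
    coordinates and of Mellin transforms leave no Jacobian behind. *)
Definition haar (R : realType) (f : R -> \bar R) : \bar R :=
  (\int[lebesgue_measure]_(r in halfline R) ((r^-1)%:E * f r))%E.

Lemma haar_scale (R : realType) (a : R) (f : R -> \bar R) : 0 < a ->
  measurable_fun setT (f : measurableTypeR R -> \bar R) ->
  (forall r, 0 < r -> (0 <= f r)%E) ->
  haar (fun r => f (a * r)) = haar f.
Proof.
move=> a0 mf f0; rewrite /haar.
have ma : measurable_fun setT (fun r : measurableTypeR R => a * r : measurableTypeR R).
  exact: measurable_funM.
have mg : measurable_fun setT (fun r : measurableTypeR R => (r^-1)%:E * f r)%E.
  apply: emeasurable_funM => //; apply/measurable_EFinP.
  exact: measurable_invr_fun.
rewrite [RHS](ge0_integral_image (m1 := lebesgue_measure) (ltW a0) ma).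
- have -> : (fun r => a * r) @^-1` `]0, +oo[%classic = `]0, +oo[%classic.
    by apply/seteqP; split => r /=; rewrite !in_itv/= !andbT pmulr_rgt0.
  rewrite -ge0_integralZl//.
  + apply: eq_integral => r; rewrite inE/= in_itv/= andbT => r0.
    by rewrite muleA -EFinM invfM mulrA divff ?gt_eqF// mul1r.
  + by apply: measurable_funTS; exact: (measurableT_comp mg ma).
  + move=> r /=; rewrite in_itv/= andbT => r0.
    by rewrite mule_ge0 ?lee_fin ?invr_ge0 ?f0 ?mulr_ge0 ?mulr_gt0// ltW.
  + by rewrite lee_fin ltW.
- move=> A mA _; have := lebesgue_measure_affine 0 a0 mA.
  by under [X in X @^-1` _]eq_fun do rewrite addr0.
- exact: measurable_itv.
- exact: measurable_funTS.
- move=> r /=; rewrite in_itv/= andbT => r0.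
  by rewrite mule_ge0 ?lee_fin ?invr_ge0 ?f0// ltW.
Qed.

Lemma eq_haar (R : realType) (f g : R -> \bar R) :
  (forall r, 0 < r -> f r = g r) -> haar f = haar g.
Proof.
move=> fg; apply: eq_integral => r.
by rewrite inE/= in_itv/= andbT => r0; rewrite fg.
Qed.

Lemma haar_ge0 (R : realType) (f : R -> \bar R) :
  (forall r, 0 < r -> (0 <= f r)%E) -> (0 <= haar f)%E.
Proof.
move=> f0; apply: integral_ge0 => r; rewrite /= in_itv/= andbT => r0.
by rewrite mule_ge0 ?f0// lee_fin invr_ge0 ltW.
Qed.

Lemma haarZl (R : realType) (c : \bar R) (f : R -> \bar R) : (0 <= c)%E ->
  measurable_fun setT (f : measurableTypeR R -> \bar R) ->
  (forall r, 0 < r -> (0 <= f r)%E) -> haar (fun r => c * f r)%E = (c * haar f)%E.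
Proof.
move=> c0 mf f0; rewrite /haar -ge0_integralZl//.
- by apply: eq_integral => r _; rewrite muleCA.
- apply: measurable_funTS; apply: emeasurable_funM => //.
  by apply/measurable_EFinP; exact: measurable_invr_fun.
- move=> r; rewrite /= in_itv/= andbT => r0.
  by rewrite mule_ge0 ?f0// lee_fin invr_ge0 ltW.
Qed.

(** The Mellin transform turns a dilation into a power: substitute r/a for r. *)
Lemma haar_power (R : realType) (i : nat) (a : R) (f : R -> \bar R) : 0 < a ->
  measurable_fun setT (f : measurableTypeR R -> \bar R) ->
  (forall r, 0 < r -> (0 <= f r)%E) ->
  haar (fun r : R => (r ^+ i)%:E * f (r * a)%R)%E =
  ((a^-1 ^+ i)%:E * haar (fun r : R => (r ^+ i)%:E * f r))%E.
Proof.
move=> a0 mf f0.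
have mg : measurable_fun setT (fun r : measurableTypeR R => (r ^+ i)%:E * f r)%E.
  by apply: emeasurable_funM => //; apply/measurable_EFinP; exact: measurable_funX.
have g0 r : 0 < r -> (0 <= (r ^+ i)%:E * f r)%E.
  by move=> r0; rewrite mule_ge0 ?f0// lee_fin exprn_ge0// ltW.
rewrite -[in RHS](haar_scale a0 mg)// -haarZl//.
- apply: eq_haar => r r0; rewrite muleA -EFinM exprMn mulrA -exprMn.
  by rewrite mulVf ?gt_eqF// expr1n mul1r (mulrC r).
- by rewrite lee_fin exprn_ge0// invr_ge0 ltW.
- apply: (measurableT_comp mg); exact: measurable_funM.
- by move=> r r0; apply: g0; rewrite mulr_gt0.
Qed.

Section haar_tonelli.
Context d (T : measurableType d) (R : realType).
Variables (m : {sigma_finite_measure set T -> \bar R}) (D : set T).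
Variable f : R -> T -> \bar R.
Hypothesis mD : measurable D.
Hypothesis mf : measurable_fun setT (fun p : measurableTypeR R * T => f p.1 p.2).
Hypothesis f0 : forall r x, 0 < r -> D x -> (0 <= f r x)%E.

Let pos : set (measurableTypeR R) := `]0, +oo[%classic.

Let mpos : measurable pos. Proof. exact: measurable_itv. Qed.

Let posP r : pos r -> 0 < r. Proof. by rewrite /pos/= in_itv/= andbT. Qed.

Let mg : measurable_fun setT
  (fun p : measurableTypeR R * T => (p.1^-1)%:E * f p.1 p.2)%E.
Proof.
apply: emeasurable_funM => //; apply/measurable_EFinP.
exact: measurable_invr_fun.
Qed.

Let g (r : measurableTypeR R) x := ((r^-1)%:E * f r x)%E.

Let g0 r x : pos r -> D x -> (0 <= g r x)%E.
Proof.
by move=> /posP r0 Dx; rewrite mule_ge0 ?f0// lee_fin invr_ge0 ltW.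
Qed.

Lemma haar_tonelli : haar (fun r => \int[m]_(x in D) f r x)%E =
  (\int[m]_(x in D) haar (fun r => f r x))%E.
Proof.
rewrite -[RHS](tonelli_on _ _ mpos mD (f := g))//.
apply: eq_integral => r /set_mem/posP r0; rewrite ge0_integralZl//.
- have mr : measurable_fun setT (fun x : T => (r, x) : measurableTypeR R * T).
    exact: measurable_fun_pair.
  by apply: measurable_funTS; exact: (measurableT_comp mf mr).
- by move=> x Dx; exact: f0.
- by rewrite lee_fin invr_ge0 ltW.
Qed.

Lemma measurable_haar : measurable_fun D (fun x => haar (fun r => f r x)).
Proof.
apply: (@measurable_integral_on _ _ _ _ _ lebesgue_measure D pos
  (fun x (r : R) => (r^-1)%:E * f r x)%E) => //.
  exact: (measurableT_comp mg (@measurable_swap _ _ _ _)).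
by move=> x r Dx pr; exact: g0.
Qed.

End haar_tonelli.

(** * Polar coordinates *)

Lemma measurable_rV_set0 (R : realType) n : measurable [set 0 : 'rV[R]_n].
Proof.
rewrite (_ : [set 0] = [set x | enorm x <= 0]).
  by apply: measurable_set_le => //; exact: measurable_enorm.
apply/seteqP; split => x /=; first by move=> ->; rewrite enorm0.
by rewrite leNgt enorm_gt0 negbK => /eqP.
Qed.

(** The origin is fixed by the dilation of ratio 2, which multiplies volumes
    by 2^n. *)
Lemma lebesgue_rV_set0 (R : realType) n : (0 < n)%N ->
  lebesgue_rV R n [set 0] = 0%E.
Proof.
move=> n0; have m0 := @measurable_rV_set0 R n.
have := lebesgue_rV_scale (ltr0n R 2) m0.
rewrite (_ : _ @^-1` _ = [set 0]); last first.
  apply/seteqP; split => x /=; last by move=> ->; rewrite scaler0.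
  by move=> /eqP; rewrite scaler_eq0 pnatr_eq0/= => /eqP.
have : lebesgue_rV R n [set 0] \is a fin_num.
  rewrite ge0_fin_numE//; apply: (@le_lt_trans _ _ (lebesgue_rV R n (unit_ball R n))).
    rewrite le_measure ?inE//; first exact: measurable_unit_ball.
    by move=> x ->; rewrite /unit_ball/= enorm0.
  by rewrite -ge0_fin_numE//; exact: lebesgue_rV_ball_fin_num.
move=> /fineK <-; rewrite -EFinM => -[] /eqP.
rewrite eq_sym -subr_eq0 -[X in _ - X]mul1r -mulrBl mulf_eq0 subr_eq0.
by rewrite gt_eqF/= ?exprn_egt1 ?ltr1n -?lt0n// => /eqP ->.
Qed.

Definition punctured_ball (R : realType) n : set 'rV[R]_n :=
  [set x | 0 < enorm x <= 1].

Arguments punctured_ball : clear implicits.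

Lemma measurable_punctured_ball (R : realType) n : measurable (punctured_ball R n).
Proof.
rewrite (_ : punctured_ball R n =
    [set x | 0 < enorm x] `&` [set x | enorm x <= 1]).
  apply: measurableI.
    by apply: measurable_set_lt => //; exact: measurable_enorm.
  by apply: measurable_set_le => //; exact: measurable_enorm.
by apply/seteqP; split => x; rewrite /punctured_ball/= => /andP.
Qed.

Lemma normalizeK (R : realType) n (x : 'rV[R]_n) : 0 < enorm x ->
  enorm x *: normalize x = x.
Proof. by move=> x0; rewrite scalerA divff ?scale1r// gt_eqF. Qed.

Lemma enorm_normalize (R : realType) n (x : 'rV[R]_n) : 0 < enorm x ->
  enorm (normalize x) = 1.
Proof.
by move=> x0; rewrite enormZ ger0_norm ?invr_ge0 ?enorm_ge0// mulVf// gt_eqF.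
Qed.

Lemma measurable_scaleV d (T : measurableType d) (R : realType) n (f : T -> R)
    (g : T -> 'rV[R]_n) : measurable_fun setT f -> measurable_fun setT g ->
  measurable_fun setT (fun x => f x *: g x).
Proof.
move=> mf mg; apply: measurable_fun_rV => i; under eq_fun do rewrite mxE.
apply: measurable_funM => //.
exact: (measurableT_comp (measurable_coord i) mg).
Qed.

Lemma integral_rV_scale (R : realType) n (s : R) (F : 'rV[R]_n -> \bar R) : 0 < s ->
  measurable_fun setT F -> (forall x, 0 <= F x)%E ->
  (\int[lebesgue_rV R n]_x F x =
   (s ^+ n)%:E * \int[lebesgue_rV R n]_x F (s *: x))%E.
Proof.
move=> s0 mF F0.
rewrite (@ge0_integral_image _ _ _ _ _ (lebesgue_rV R n) _ (s ^+ n) (fun x => s *: x))//.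
- by rewrite exprn_ge0// ltW.
- exact: measurable_scaleV.
- by move=> A mA _; exact: lebesgue_rV_scale.
Qed.

(** Its value is 1/n: it is the integral of s^(-n) ds/s over s >= 1. *)
Definition polar_const (R : realType) n : \bar R :=
  haar (fun s : R => ((1 <= s)%R%:R * (s^-1) ^+ n)%:E).

Section polar.
Variables (R : realType) (n : nat) (F : 'rV[R]_n -> \bar R).
Hypotheses (n0 : (0 < n)%N) (mF : measurable_fun setT F).
Hypothesis F0 : forall x, (0 <= F x)%E.

Let nu := lebesgue_rV R n.
Let B0 := punctured_ball R n.
Let mB0 : measurable B0 := @measurable_punctured_ball R n.

Let S (r : R) := [set y : 'rV[R]_n | 0 < enorm y <= r].

Let w (r : R) (y : 'rV[R]_n) := \1_(S r) y * (enorm y * r^-1) ^+ n.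

Let menorm d (T : measurableType d) (g : T -> 'rV[R]_n) :
  measurable_fun setT g -> measurable_fun setT (fun x => enorm (g x)).
Proof. by move=> mg; apply: (measurableT_comp _ mg); exact: measurable_enorm. Qed.

Let mw : measurable_fun setT
  (fun p : measurableTypeR R * 'rV[R]_n => w p.1 p.2).
Proof.
apply: measurable_funM; last first.
  apply: measurable_funX; apply: measurable_funM; first exact: menorm.
  exact: measurable_invr_fun.
rewrite (_ : (fun p => _) = \1_([set p : measurableTypeR R * 'rV[R]_n | 0 < enorm p.2] `&`
   [set p : measurableTypeR R * 'rV[R]_n | enorm p.2 <= p.1])).
  apply: measurable_indic; apply: measurableI.
    by apply: measurable_set_lt => //; exact: menorm.
  by apply: measurable_set_le => //; exact: menorm.
apply/funext => p; rewrite !indicE; congr (nat_of_bool _)%:R.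
by apply/idP/idP; rewrite !inE/= => /andP.
Qed.

Let mwr (r : R) : measurable_fun setT (w r).
Proof.
pose h (y : 'rV[R]_n) : measurableTypeR R * 'rV[R]_n := (r, y).
have mh : measurable_fun setT h by exact: measurable_fun_pair.
exact: (measurableT_comp mw mh).
Qed.

Let w0 r y : 0 < r -> 0 <= w r y.
Proof.
by move=> r0; rewrite mulr_ge0// exprn_ge0// mulr_ge0 ?enorm_ge0// invr_ge0 ltW.
Qed.

Let T := (measurableTypeR R * 'rV[R]_n)%type.

Let haar_w y : y != 0 -> haar (fun r => (w r y)%:E) = polar_const R n.
Proof.
rewrite -enorm_gt0 => y0; rewrite /polar_const.
rewrite -[RHS](@haar_scale _ (enorm y)^-1) ?invr_gt0//.
- congr haar; apply/funext => r; rewrite /w indicE; congr ((nat_of_bool _)%:R * _)%:E.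
    rewrite mulrC ler_pdivlMr// mul1r.
    by apply/idP/idP; rewrite inE /S/= y0.
  by rewrite invfM invrK.
- apply/measurable_EFinP; apply: measurable_funM; last first.
    by apply: measurable_funX; exact: measurable_invr_fun.
  rewrite (_ : (fun _ => _) = \1_(`[1, +oo[%classic : set (measurableTypeR R))).
    by apply: measurable_indic; exact: measurable_itv.
  by apply/funext => r; rewrite indicE; congr (nat_of_bool _)%:R;
    apply/idP/idP; rewrite inE/= in_itv/= andbT.
- move=> r r0; rewrite lee_fin mulr_ge0// exprn_ge0// invr_ge0 ltW//.
Qed.

(** The sphere is represented by the punctured ball, on which functions of
    normalize x are integrated, as in the definition of the surface measure.
    Writing r |x| for r on the right-hand side removes normalize; substituting
    y = r x then gives the integral over r and y of F y weighted by
    w r y = (|y|/r)^n for |y| <= r. The integral of w in r is the constant. *)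
Lemma polar_coordinates :
  (polar_const R n * \int[nu]_x F x =
   \int[nu]_(x in B0) haar (fun r => (r ^+ n)%:E * F (r *: normalize x)%R))%E.
Proof.
have F1 x : measurable_fun setT (fun r : measurableTypeR R => F (r *: x)).
  by apply: (measurableT_comp mF); exact: measurable_scaleV.
have mF2 : measurable_fun setT (fun p : T => F (p.1 *: p.2)).
  by apply: (measurableT_comp mF); exact: measurable_scaleV.
have mF3 : measurable_fun setT (fun p : T => F p.2) by exact: measurableT_comp.
transitivity (haar (fun r => \int[nu]_y ((w r y)%:E * F y)))%E; last first.
  transitivity (\int[nu]_(x in B0)
      haar (fun r => ((enorm x * r) ^+ n)%:E * F (r *: x)%R))%E; last first.
    apply: eq_integral => x; rewrite inE => /andP[x0 x1].
    rewrite -[RHS](haar_scale x0).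
    - congr haar; apply/funext => r.
      by rewrite [in RHS](mulrC _ r) -scalerA normalizeK// [in RHS](mulrC r).
    - apply: emeasurable_funM => //.
      by apply/measurable_EFinP; exact: measurable_funX.
    - by move=> r r0; rewrite mule_ge0// lee_fin exprn_ge0// ltW.
  rewrite -[RHS](haar_tonelli nu mB0
      (f := fun (r : R) x => ((enorm x * r) ^+ n)%:E * F (r *: x))%E); last 2 first.
  - apply: emeasurable_funM => //; apply/measurable_EFinP; apply: measurable_funX.
    by apply: measurable_funM => //; exact: menorm.
  - by move=> r x r0 _; rewrite mule_ge0// lee_fin exprn_ge0// mulr_ge0 ?enorm_ge0// ltW.
  rewrite /haar; apply: eq_integral => r; rewrite inE/= in_itv/= andbT => r0.
  congr (_ * _)%E; rewrite (integral_rV_scale r0).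
  - rewrite -ge0_integralZl//; last 3 first.
    + have mr : measurable_fun setT (fun x : 'rV[R]_n => r *: x).
        exact: measurable_scaleV.
      apply: emeasurable_funM; last exact: measurableT_comp.
      by apply/measurable_EFinP; exact: (measurableT_comp (mwr r)).
    + by move=> x _; rewrite mule_ge0// lee_fin w0.
    + by rewrite lee_fin exprn_ge0// ltW.
    rewrite [RHS]integral_mkcond; apply: eq_integral => x _.
    have Sr : (r *: x \in S r) = (x \in B0).
      apply/idP/idP; rewrite !inE /S /B0 /punctured_ball/= enormZ gtr0_norm//;
        by rewrite pmulr_rgt0// ger_pMr.
    rewrite patchE /w indicE Sr; case: ifPn => _; last by rewrite mul0r mul0e mule0.
    rewrite mul1r enormZ gtr0_norm// muleA -EFinM -exprMn.
    by rewrite [r * _ / _]mulrAC divff ?gt_eqF// mul1r mulrC.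
  - by apply: emeasurable_funM => //; exact/measurable_EFinP.
  - by move=> x; rewrite mule_ge0// lee_fin w0.
have mwF : measurable_fun setT (fun p : T => ((w p.1 p.2)%:E * F p.2)%E).
  by apply: emeasurable_funM => //; exact/measurable_EFinP.
(* the weight w integrates to the constant only for y != 0 *)
pose D := ~` [set 0 : 'rV[R]_n].
have mD : measurable D by apply: measurableC; exact: measurable_rV_set0.
have nuD g : measurable_fun setT g -> (forall x, 0 <= g x)%E ->
    (\int[nu]_x g x = \int[nu]_(x in D) g x)%E.
  move=> mg g0; rewrite (@ge0_negligible_integral _ _ _ nu setT [set 0])//.
  - by rewrite setTD.
  - exact: measurable_rV_set0.
  - exact: lebesgue_rV_set0.
transitivity (haar (fun r => \int[nu]_(y in D) ((w r y)%:E * F y)))%E; last first.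
  rewrite /haar; apply: eq_integral => r; rewrite inE/= in_itv/= andbT => r0.
  rewrite nuD//; first by apply: emeasurable_funM => //; exact/measurable_EFinP.
  by move=> x; rewrite mule_ge0// lee_fin w0.
rewrite (haar_tonelli nu mD mwF); last first.
  by move=> r x r0 _; rewrite mule_ge0// lee_fin w0.
rewrite nuD// -ge0_integralZl//; last 2 first.
- exact: measurable_funTS.
- by apply: integral_ge0 => r; rewrite /= in_itv/= andbT => r0;
    rewrite -EFinM lee_fin mulr_ge0 ?invr_ge0 ?mulr_ge0 ?exprn_ge0 ?invr_ge0// ltW.
apply: eq_integral => y; rewrite inE/= => /eqP y0.
rewrite -(haar_w y0) /haar -ge0_integralZr//.
- by apply: eq_integral => r _; rewrite muleA.
- apply: measurable_funTS; apply/measurable_EFinP; apply: measurable_funM.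
    exact: measurable_invr_fun.
  have my : measurable_fun setT (fun r => (r, y) : T) by exact: measurable_fun_pair.
  exact: (measurableT_comp mw my).
- move=> r /=; rewrite in_itv/= andbT => r0.
  by rewrite -EFinM lee_fin mulr_ge0 ?w0// invr_ge0 ltW.
Qed.

End polar.

Lemma integrable_oneDsqrV (R : realType) (C : R) : 0 <= C ->
  lebesgue_measure.-integrable (halfline R)
    (fun u => (C * (1 + u ^+ 2)^-1)%:E).
Proof.
move=> C0; pose f (u : measurableTypeR R) : R := (1 + u ^+ 2)^-1.
have f0 u : 0 <= f u by rewrite invr_ge0 addr_ge0 ?sqr_ge0.
have mf : measurable_fun setT (fun u : measurableTypeR R => (f u)%:E).
  apply/measurable_EFinP; apply: measurable_invr_fun.
  by apply: measurable_funD => //; exact: measurable_funX.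
have mCf : measurable_fun setT (fun u : measurableTypeR R => (C * f u)%:E).
  by under eq_fun do rewrite EFinM; exact: emeasurable_funM.
apply/integrableP; split; first exact: measurable_funTS.
rewrite (eq_integral (fun u : measurableTypeR R => (C%:E * (f u)%:E)%E)); last first.
  by move=> u _; rewrite -EFinM gee0_abs// lee_fin mulr_ge0// f0.
rewrite ge0_integralZl//; first last.
- by move=> u _; rewrite lee_fin.
- exact: measurable_funTS.
rewrite integral_itv_obnd_cbnd; last exact: measurable_funTS.
by rewrite [X in (_ * X)%E]integral0y_oneDsqr -EFinM ltry.
Qed.

Lemma polar_constE (R : realType) n : polar_const R n =
  (\int[lebesgue_measure]_(s in halfline R) (((1 <= s)%R%:R * (s^-1) ^+ n.+1)%:E))%E.
Proof.
by apply: eq_integral => s _; rewrite -EFinM exprS mulrCA.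
Qed.

Lemma measurable_polar_integrand (R : realType) n :
  measurable_fun setT (fun s : measurableTypeR R => ((1 <= s)%R%:R * (s^-1) ^+ n.+1)%:E).
Proof.
under eq_fun do rewrite EFinM.
apply: emeasurable_funM; first exact: measurable_EFin_le.
by apply/measurable_EFinP; apply: measurable_funX; exact: measurable_invr_fun.
Qed.

(** On s >= 1 the integrand s^(-n-1) is at most 2/(1 + s^2). *)
Lemma polar_const_fin_num (R : realType) n : (0 < n)%N ->
  polar_const R n \is a fin_num.
Proof.
move=> n0; rewrite polar_constE; apply: integrable_fin_num => //.
apply: le_integrable (integrable_oneDsqrV (ler0n R 2)) => //.
  by apply: measurable_funTS; exact: measurable_polar_integrand.
move=> s; rewrite /= in_itv/= andbT => s0.
have s20 : 0 < 1 + s ^+ 2 by rewrite ltr_pwDl// sqr_ge0.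
rewrite !ger0_norm ?lee_fin; last 2 first.
- by rewrite mulr_ge0 ?invr_ge0 ?(ltW s20).
- by rewrite mulr_ge0// exprn_ge0// invr_ge0 ltW.
case: (leP 1 s) => s1; last by rewrite mul0r mulr_ge0 ?invr_ge0 ?(ltW s20).
rewrite mul1r; apply: (@le_trans _ _ (s^-1 ^+ 2)).
  by rewrite ler_wiXn2l ?invr_ge0 ?(ltW s0)// invf_le1.
rewrite exprVn ler_pdivlMr// ler_pdivrMl ?exprn_gt0// mulr_natr.
by rewrite mulr2n lerD2r -(expr1n _ 2) lerXn2r// nnegrE ltW.
Qed.

(** On [1, 2] the integrand is at least 2^(-n-1). *)
Lemma polar_const_gt0 (R : realType) n : (0 < polar_const R n)%E.
Proof.
have mg := @measurable_polar_integrand R n.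
pose I12 : set (measurableTypeR R) := `[1, 2]%classic.
have mI : measurable I12 by exact: measurable_itv.
apply: (@lt_le_trans _ _ (\int[lebesgue_measure]_(s in I12) (2^-1 ^+ n.+1)%:E)%E).
  have mu12 : lebesgue_measure I12 = 1%E.
    by rewrite lebesgue_measure_itv/= lte_fin ltr1n -EFinB (_ : 2 - 1 = 1 :> R)//; ring.
  by rewrite integral_cst// [X in (_ * X)%E]mu12 mule1 lte_fin exprn_gt0// invr_gt0.
rewrite polar_constE.
apply: (@le_trans _ _ (\int[lebesgue_measure]_(s in I12)
    (((1 <= s)%R%:R * (s^-1) ^+ n.+1)%:E))%E).
  apply: ge0_le_integral => //.
  - exact: measurable_funTS.
  - move=> s; rewrite /I12/= in_itv/= => /andP[s1 s2].
    rewrite lee_fin s1 mul1r lerXn2r// ?nnegrE ?invr_ge0//.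
      by rewrite (le_trans _ s1).
    by rewrite lef_pV2 ?posrE// (lt_le_trans _ s1).
apply: ge0_subset_integral => //; first exact: measurable_funTS.
- move=> s; rewrite /= in_itv/= andbT => s0.
  by rewrite lee_fin mulr_ge0// exprn_ge0// invr_ge0 ltW.
- move=> s; rewrite /I12/= !in_itv/= andbT => /andP[s1 _].
  by rewrite (lt_le_trans _ s1).
Qed.

(** * Dual volumes of the body defined by a gauge *)

Lemma measurable_sphere (R : realType) n : measurable (@sphere R n).
Proof.
have me : measurable_fun setT (@enorm R n) by exact: measurable_enorm.
rewrite (_ : @sphere R n = [set x | enorm x <= 1] `&` [set x | 1 <= enorm x]).
  by apply: measurableI; apply: measurable_set_le.
apply/seteqP; split => x; rewrite /sphere/=; first by move=> ->.
by move=> [x1 x2]; apply/eqP; rewrite eq_le x1.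
Qed.

(** The surface measure is the image of n times the Lebesgue measure by the map that
    normalizes the points of the punctured ball and sends all other points to 0,
    off the sphere. *)
Lemma sphere_integral (R : realType) n (h : 'rV[R]_n -> \bar R) :
  measurable_fun setT h -> (forall x, @sphere R n x -> 0 <= h x)%E ->
  (\int[@sphere_measure R n]_(x in @sphere R n) h x =
   n%:R%:E * \int[lebesgue_rV R n]_(x in punctured_ball R n) h (normalize x))%E.
Proof.
move=> mh h0.
pose f (x : 'rV[R]_n) := \1_(punctured_ball R n) x *: normalize x.
have mB := @measurable_punctured_ball R n.
have mf : measurable_fun setT f.
  by apply: measurable_scaleV; [exact: measurable_indic|exact: measurable_normalize].
have fE (A : set 'rV[R]_n) : A `<=` @sphere R n ->
    f @^-1` A = punctured_ball R n `&` (@normalize R n) @^-1` A.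
  move=> AS; apply/seteqP; split => x /=; rewrite /f indicE; last first.
    by move=> [Bx Ax]; rewrite mem_set// scale1r.
  case: (boolP (x \in punctured_ball R n)) => [/set_mem Bx|_]; rewrite ?scale1r//.
  by rewrite scale0r => /AS; rewrite /sphere/= enorm0 => /eqP; rewrite eq_sym oner_eq0.
rewrite (ge0_integral_image (m1 := lebesgue_rV R n) (ler0n R n) mf).
- rewrite fE//; congr (_ * _)%E.
  have -> : punctured_ball R n `&` (@normalize R n) @^-1` (@sphere R n) = punctured_ball R n.
    apply/setIidl => x /= /andP[x0 _]; exact: enorm_normalize.
  by apply: eq_integral => x xB; rewrite /f indicE xB scale1r.
- by move=> A mA AS; rewrite fE.
- exact: measurable_sphere.
- exact: measurable_funTS.
- by [].
Qed.

Section gauge.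
Variables (R : realType) (n : nat) (g : 'rV[R]_n -> R).
Hypotheses (n0 : (0 < n)%N) (mg : measurable_fun setT g).
Hypothesis g0 : forall x, x != 0 -> 0 < g x.
Hypothesis gZ : forall (r : R) x, 0 <= r -> g (r *: x) = r * g x.

Let nu := lebesgue_rV R n.
Let B0 := punctured_ball R n.

Let sphere_neq0 x : @sphere R n x -> x != 0.
Proof. by rewrite /sphere/= -enorm_gt0 => ->. Qed.

Let gN x : B0 x -> 0 < g (normalize x).
Proof.
by move=> /andP[x0 _]; apply: g0; rewrite -enorm_gt0 enorm_normalize.
Qed.

Lemma radial_gauge x : x != 0 -> radial [set y | g y <= 1] x = (g x)^-1.
Proof.
move=> /g0 gx0; rewrite /radial (_ : [set a | _] = `[0, (g x)^-1]%classic).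
  by rewrite sup_itvcc// invr_ge0 ltW.
apply/seteqP; split => a /=; rewrite in_itv/=.
  by move=> [a0]; rewrite gZ// -ler_pdivlMr// mul1r a0.
by move=> /andP[a0 ag]; rewrite gZ// -ler_pdivlMr// mul1r.
Qed.

Lemma dual_volume_gauge i : dual_volume i [set x | g x <= 1] =
  (\int[nu]_(x in B0) (((g (normalize x))^-1) ^+ i)%:E)%E.
Proof.
rewrite /dual_volume.
under eq_integral.
  move=> x /set_mem xS; rewrite radial_gauge; last exact: sphere_neq0.
  over.
rewrite (sphere_integral (h := fun x => ((g x)^-1 ^+ i)%:E)).
- by rewrite muleA -EFinM mulVf ?mul1e// pnatr_eq0 -lt0n.
- apply/measurable_EFinP; apply: measurable_funX; exact: measurable_invr_fun.
- by move=> x /sphere_neq0/g0 gx; rewrite lee_fin exprn_ge0// invr_ge0 ltW.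
Qed.

Let mgN : measurable_fun setT (g \o @normalize R n).
Proof. apply: measurableT_comp => //; exact: measurable_normalize. Qed.

(** In polar coordinates the volume of {g <= 1} is the integral over the sphere of
    that of r^n over r <= 1/g; by [haar_power] the latter is a constant times
    g^(-n). *)
Lemma volume_of_dual_volume : (polar_const R n * nu [set x | g x <= 1]%R =
  haar (fun r : R => (r ^+ n)%:E * ((r <= 1)%R%:R)%:E) *
  dual_volume n [set x | g x <= 1]%R)%E.
Proof.
rewrite -integral_EFin_le// polar_coordinates//; last exact: measurable_EFin_le.
have mle : measurable_fun setT (fun r : measurableTypeR R => ((r <= 1)%R%:R)%:E : \bar R).
  exact: measurable_EFin_le.
rewrite dual_volume_gauge// -ge0_integralZl//; first last.
- by apply: haar_ge0 => r r0; rewrite mule_ge0// lee_fin exprn_ge0// ltW.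
- by move=> x /gN gx; rewrite lee_fin exprn_ge0// invr_ge0 ltW.
- apply: measurable_funTS; apply/measurable_EFinP; apply: measurable_funX.
  exact: measurable_invr_fun.
- exact: measurable_punctured_ball.
apply: eq_integral => x /set_mem xB.
rewrite [RHS]muleC -(haar_power n (gN xB) mle)//.
by apply: eq_haar => r r0; rewrite gZ// ltW.
Qed.

(** Tonelli, then the substitution v = u g(theta) in the inner integral, which
    takes out the factor g(theta)^(-i). *)
Lemma haar_dual_volume i (phi : measurableTypeR R -> \bar R) :
  measurable_fun setT phi -> (forall u, 0 <= phi u)%E ->
  haar (fun u : R => (u ^+ i)%:E * \int[nu]_(x in B0) phi (u * g (normalize x))%R)%E =
  (haar (fun u : R => (u ^+ i)%:E * phi u) *
   dual_volume i [set x | g x <= 1]%R)%E.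
Proof.
move=> mphi phi0; have mB : measurable B0 by exact: measurable_punctured_ball.
have mug : measurable_fun setT
    (fun p : measurableTypeR R * 'rV[R]_n => p.1 * g (normalize p.2)).
  by apply: measurable_funM => //; exact: (measurableT_comp mgN).
transitivity (haar (fun u : R => \int[nu]_(x in B0)
    ((u ^+ i)%:E * phi (u * g (normalize x))%R)))%E.
  apply: eq_haar => u u0; rewrite ge0_integralZl//.
  - apply: measurable_funTS; apply: (measurableT_comp mphi).
    exact: measurable_funM.
  - by rewrite lee_fin exprn_ge0// ltW.
rewrite (haar_tonelli nu mB
    (f := fun (u : R) x => ((u ^+ i)%:E * phi (u * g (normalize x))%R)%E)); last 2 first.
- apply: emeasurable_funM.
    by apply/measurable_EFinP; exact: measurable_funX.
  exact: (measurableT_comp mphi mug).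
- by move=> r x r0 _; rewrite mule_ge0// lee_fin exprn_ge0// ltW.
rewrite dual_volume_gauge// -ge0_integralZl//; first last.
- by apply: haar_ge0 => r r0; rewrite mule_ge0// lee_fin exprn_ge0// ltW.
- by move=> x /gN gx; rewrite lee_fin exprn_ge0// invr_ge0 ltW.
- apply: measurable_funTS; apply/measurable_EFinP; apply: measurable_funX.
  exact: measurable_invr_fun.
apply: eq_integral => x /set_mem xB.
by rewrite [RHS]muleC -(haar_power i (gN xB) mphi).
Qed.

End gauge.

(** The part of the segment in direction theta that lies in
    |x|^2 + u^2 g(x)^2 <= 1, measured by r^n dr/r, where v = u g(theta); its value is
    (1 + v^2)^(-n/2) / n. *)
Definition radial_mass (R : realType) (n : nat) (v : R) : \bar R :=
  haar (fun r : R => (r ^+ n)%:E * ((r ^+ 2 * (1 + v ^+ 2) <= 1)%R%:R)%:E)%E.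

Lemma measurable_radial_mass (R : realType) (n : nat) :
  measurable_fun setT (@radial_mass R n : measurableTypeR R -> \bar R).
Proof.
apply: (@measurable_haar _ (measurableTypeR R) R setT
  (fun r v => (r ^+ n)%:E * ((r ^+ 2 * (1 + v ^+ 2) <= 1)%R%:R)%:E)%E) => //.
  apply: emeasurable_funM.
    by apply/measurable_EFinP; exact: measurable_funX.
  apply: measurable_EFin_le => //; apply: measurable_funM; first exact: measurable_funX.
  by apply: measurable_funD => //; exact: measurable_funX.
by move=> r x r0 _; rewrite mule_ge0// lee_fin// exprn_ge0// ltW.
Qed.

Lemma radial_mass_ge0 (R : realType) (n : nat) (v : R) : (0 <= radial_mass n v)%E.
Proof. by apply: haar_ge0 => r r0; rewrite mule_ge0// lee_fin exprn_ge0// ltW. Qed.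

Lemma volume_ball_gauge (R : realType) (n : nat) (g : 'rV[R]_n -> R) (u : R) :
  (0 < n)%N -> measurable_fun setT g ->
  (forall (r : R) x, 0 <= r -> g (r *: x) = r * g x) ->
  (polar_const R n * lebesgue_rV R n [set x | enorm x ^+ 2 + (u * g x) ^+ 2 <= 1]%R =
   \int[lebesgue_rV R n]_(x in punctured_ball R n) radial_mass n (u * g (normalize x))%R)%E.
Proof.
move=> n0 mg gZ.
have mu1 : measurable_fun setT (fun x : 'rV[R]_n => enorm x ^+ 2 + (u * g x) ^+ 2).
  apply: measurable_funD; apply: measurable_funX; first exact: measurable_enorm.
  exact: measurable_funM.
have m1 : measurable_fun setT (fun _ : 'rV[R]_n => 1 : R) by exact: measurable_cst.
have := integral_EFin_le (lebesgue_rV R n) mu1 m1 => /= <-.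
have F0 (x : 'rV[R]_n) : (0 <= ((enorm x ^+ 2 + (u * g x) ^+ 2 <= 1)%R%:R)%:E :> \bar R)%E.
  by rewrite lee_fin.
rewrite (polar_coordinates n0 (measurable_EFin_le mu1 m1) F0).
apply: eq_integral => x /set_mem xB.
rewrite /radial_mass; apply: eq_haar => r r0; rewrite (gZ _ _ (ltW r0)) enormZ gtr0_norm//.
rewrite enorm_normalize ?mulr1; last by case/andP: xB.
by rewrite mulrCA exprMn mulrDr mulr1.
Qed.

(** * A polynomial with prescribed signs *)

(** Each positive root r of S, with its multiplicity, gives a factor X - sqrt r
    of q, since u^2 - r = (u - sqrt r) (u + sqrt r) and the last factor is positive.
    When no positive root is left, S has a constant sign on the positive reals, by
    the intermediate value theorem. *)
Lemma poly_sign_companion (R : rcfType) (S : {poly R}) : S != 0 ->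
  exists q : {poly R}, [/\ q != 0, (size q <= size S)%N &
    forall u, 0 < u -> 0 <= q.[u] * S.[u ^+ 2]].
Proof.
have [k] := ubnP (size S); elim: k S => // k IHk S; rewrite ltnS => Sk S0.
have [[r r0 /factor_theorem[S' SE]]|noroot] :=
    pselect (exists2 r, 0 < r & root S r).
  have S'0 : S' != 0 by apply: contra_neq S0 => S'0; rewrite SE S'0 mul0r.
  have sS : size S = (size S').+1 by rewrite SE size_Mmonic ?monicXsubC// size_XsubC addn2.
  have [|q [q0 sq qS]] := IHk S' _ S'0; first by rewrite -ltnS -sS.
  exists (q * ('X - (Num.sqrt r)%:P)); split.
  - by rewrite mulf_neq0// polyXsubC_eq0.
  - by rewrite size_Mmonic ?monicXsubC// size_XsubC addn2 sS.
  - move=> u u0; rewrite SE !(hornerM, hornerXsubC).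
    have -> : q.[u] * (u - Num.sqrt r) * (S'.[u ^+ 2] * (u ^+ 2 - r)) =
        q.[u] * S'.[u ^+ 2] * ((u - Num.sqrt r) ^+ 2 * (u + Num.sqrt r)).
      by rewrite -[X in u ^+ 2 - X](sqr_sqrtr (ltW r0)); ring.
    by rewrite mulr_ge0 ?qS// mulr_ge0 ?sqr_ge0// addr_ge0 ?sqrtr_ge0// ltW.
have pos1 v : 0 < v -> S.[v] != 0.
  by move=> v0; apply/negP => Sv; apply: noroot; exists v.
exists (S.[1])%:P; split; first by rewrite polyC_eq0 pos1.
  by rewrite size_polyC pos1 ?ltr01// size_poly_gt0.
move=> u u0; rewrite hornerC leNgt; apply/negP => neg.
have u20 : 0 < u ^+ 2 by rewrite exprn_gt0.
(* p is positive at 1 and negative at u^2, so it has a root between them *)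
pose p := S.[1] *: S.
have p1 : 0 <= p.[1] by rewrite hornerZ -expr2 sqr_ge0.
have pu : p.[u ^+ 2] <= 0 by rewrite hornerZ ltW.
have rootp x : 0 < x -> root p x -> False.
  move=> x0; rewrite /root hornerZ mulf_eq0 (negbTE (pos1 1 ltr01))/=.
  by move: (pos1 x x0) => /negP.
have [u1|u1] := leP (u ^+ 2) 1.
  have [|x /andP[ux _] px] := poly_ivt (p := p) u1; first by rewrite pu.
  exact: (rootp x (lt_le_trans u20 ux)).
have [|x /andP[ux _] px] := poly_ivt (p := - p) (ltW u1).
  by rewrite !hornerN oppr_le0 p1 oppr_ge0.
by apply: (rootp x (lt_le_trans ltr01 ux)); rewrite -rootN.
Qed.

Lemma finite_roots (R : idomainType) (p : {poly R}) : p != 0 ->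
  finite_set [set x | root p x].
Proof.
have [k] := ubnP (size p); elim: k p => // k IHk p; rewrite ltnS => pk p0.
have [[r /factor_theorem[q pE]]|noroot] := pselect (exists r, root p r); last first.
  rewrite (_ : [set _ | _] = set0) //; rewrite -subset0 => x px.
  by apply: noroot; exists x.
have q0 : q != 0 by apply: contra_neq p0 => q0; rewrite pE q0 mul0r.
have sp : size p = (size q).+1 by rewrite pE size_Mmonic ?monicXsubC// size_XsubC addn2.
have fq : finite_set [set x | root q x] by apply: IHk => //; rewrite -ltnS -sp.
apply: (@sub_finite_set _ _ ([set x | root q x] `|` [set r])).
  by move=> x /=; rewrite pE rootM root_XsubC => /orP[|/eqP]; [left|right].
by rewrite finite_setU; split.
Qed.

(** * Moments that determine a product of positive linear factors *)

(** A nonnegative function with integral 0 vanishes almost everywhere; here its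
    zeros would be a finite set of full measure in the half-line. *)
Lemma integral_neq0_of_roots (R : realType) (g : measurableTypeR R -> R) (T : {poly R}) :
  T != 0 -> measurable_fun setT g -> (forall u, 0 < u -> 0 <= g u) ->
  (forall u, 0 < u -> g u = 0 -> root T u) ->
  (\int[lebesgue_measure]_(u in halfline R) (g u)%:E)%E != 0%E.
Proof.
move=> T0 mg g0 gT; apply/eqP => int0.
have mg' : measurable_fun (halfline R) (EFin \o g).
  by apply: measurable_funTS; exact/measurable_EFinP.
have : (\int[lebesgue_measure]_(u in (halfline R)) `|(g u)%:E| = 0)%E.
  rewrite -[RHS]int0; apply: eq_integral => u; rewrite inE/= in_itv/= andbT => u0.
  by rewrite ger0_norm ?g0.
move=> /(ae_eq_integral_abs lebesgue_measure (measurable_itv _) mg')[N [mN N0 sN]].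
pose Z : set (measurableTypeR R) := [set u | root T u].
have cZ : countable Z by apply: finite_set_countable; exact: finite_roots.
have mZ : measurable Z by apply: countable_measurable => // t; exact: measurable_set1.
have sub : (halfline R) `<=` N `|` Z.
  move=> u hu; have [Zu|nZu] := pselect (Z u); [by right|left].
  have u0 : 0 < u by move: hu; rewrite /= in_itv/= andbT.
  by apply: sN => /= /(_ hu) [] /(gT _ u0).
have : (lebesgue_measure (halfline R) <= 0)%E.
  apply: (le_trans (le_measure _ _ _ sub)); rewrite ?inE//; first exact: measurableU.
  apply: (@le_trans _ _ (lebesgue_measure N + lebesgue_measure Z)%E).
    exact: measureU2.
  by rewrite N0 add0e countable_lebesgue_measure0.
suff -> : lebesgue_measure (halfline R) = +oo%E by [].
by rewrite [LHS]lebesgue_measure_itv/= ltry.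
Qed.

(** The factor of the volume of {|x|^2 + u^2 g(x)^2 <= 1} that depends on u, when b
    lists the squares of the semi-axes of {g <= 1}. *)
Definition decay (R : realType) n (b : 'I_n -> R) (u : R) : R :=
  (Num.sqrt (\prod_k (u ^+ 2 + b k)))^-1.

Lemma measurable_decay (R : realType) n (b : 'I_n -> R) :
  measurable_fun setT (decay b : measurableTypeR R -> R).
Proof.
apply: measurable_invr_fun; apply: measurable_sqrt_fun.
by apply: measurable_prod => k _; apply: measurable_funD => //; exact: measurable_funX.
Qed.

Lemma prod_addr_gt0 (R : numDomainType) n (b : 'I_n -> R) (t : R) :
  (forall k, 0 < b k) -> 0 <= t -> 0 < \prod_k (t + b k).
Proof. by move=> b0 t0; apply: prodr_gt0 => k _; rewrite ltr_wpDl. Qed.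

(** With w = sqrt (1 + u^2), both u <= w and 1 <= w hold, and
    w^2 <= (1 + 1/b_k) (u^2 + b_k) for each k; hence u^j w^2 <= w^n <= C / decay b u. *)
Lemma decay_bound (R : realType) n (b : 'I_n -> R) : (forall k, 0 < b k) ->
  exists2 C : R, 0 < C & forall (j : nat) (u : R), (j.+2 <= n)%N -> 0 <= u ->
    u ^+ j * decay b u <= C * (1 + u ^+ 2)^-1.
Proof.
move=> b0; pose c k := 1 + (b k)^-1.
have c0 k : 0 < c k by rewrite addr_gt0// invr_gt0.
exists (Num.sqrt (\prod_k c k)).
  by rewrite sqrtr_gt0; apply: prodr_gt0.
move=> j u jn u0; have Pu := prod_addr_gt0 b0 (sqr_ge0 u).
have w0 : 0 < 1 + u ^+ 2 by rewrite ltr_pwDl// sqr_ge0.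
rewrite ler_pdivrMr ?sqrtr_gt0// mulrAC ler_pdivlMr// -sqrtrM; last first.
  by apply: prodr_ge0 => k _; rewrite ltW.
rewrite -big_split/=.
pose w := Num.sqrt (1 + u ^+ 2).
have w2 : w ^+ 2 = 1 + u ^+ 2 by rewrite sqr_sqrtr// ltW.
have uw : u <= w by rewrite -[leLHS](ger0_norm u0) -sqrtr_sqr ler_wsqrtr// lerDr.
have w1 : 1 <= w by rewrite -[leLHS]sqrtr1 ler_wsqrtr// lerDl sqr_ge0.
have wge0 : 0 <= w by rewrite (le_trans u0).
rewrite -w2; apply: (@le_trans _ _ (w ^+ n)).
  apply: (@le_trans _ _ (w ^+ j.+2)); last by rewrite ler_weXn2l.
  by rewrite -[j.+2]addn2 exprD ler_wpM2r ?exprn_ge0// lerXn2r ?nnegrE.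
rewrite -[leLHS]ger0_norm ?exprn_ge0// -sqrtr_sqr ler_wsqrtr//.
rewrite -exprM mulnC exprM -[n in _ ^+ n]card_ord -prodr_const.
apply: ler_prod => k _; rewrite sqr_ge0/= w2 /c mulrDl mul1r mulrDr mulVf ?gt_eqF//.
rewrite addrC -addrA lerD2l; apply: (@le_trans _ _ (b k + 1)); first by rewrite lerDr ltW.
by rewrite lerD2l lerDr mulr_ge0 ?sqr_ge0// invr_ge0 ltW.
Qed.

Lemma integrable_decay (R : realType) n (b : 'I_n -> R) (j : nat) :
  (forall k, 0 < b k) -> (j.+2 <= n)%N ->
  lebesgue_measure.-integrable (halfline R)
    (fun u => (u ^+ j * decay b u)%:E).
Proof.
move=> b0 jn; have [C C0 bound] := decay_bound b0.
apply: le_integrable (integrable_oneDsqrV (ltW C0)) => //.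
- apply: measurable_funTS; apply/measurable_EFinP; apply: measurable_funM.
    exact: measurable_funX.
  exact: measurable_decay.
- move=> u; rewrite /= in_itv/= andbT => u0.
  rewrite !ger0_norm ?lee_fin ?bound ?(ltW u0)//.
    by rewrite mulr_ge0 ?invr_ge0 ?(ltW C0)// addr_ge0 ?sqr_ge0.
  by rewrite mulr_ge0 ?invr_ge0 ?sqrtr_ge0// exprn_ge0// ltW.
Qed.

(** One factor u compensates the density of du/u. *)
Lemma haar_exprS (R : realType) (j : nat) (f : R -> R) :
  haar (fun u : R => (u ^+ j.+1)%:E * (f u)%:E)%E =
  (\int[lebesgue_measure]_(u in halfline R) (u ^+ j * f u)%:E)%E.
Proof.
apply: eq_integral => u; rewrite inE/= in_itv/= andbT => u0.
by rewrite -!EFinM exprS !mulrA mulVf ?mul1r// gt_eqF.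
Qed.

(** Linearity: the assumed equalities are the cases q = X^j. The integrability of
    each term allows to subtract. *)
Lemma integral_poly_decay (R : realType) n (b c : 'I_n -> R) (q : {poly R}) :
  (forall k, 0 < b k) -> (forall k, 0 < c k) -> (size q < n)%N ->
  (forall i, (1 <= i < n)%N ->
    haar (fun u : R => (u ^+ i)%:E * (decay b u)%:E)%E =
    haar (fun u : R => (u ^+ i)%:E * (decay c u)%:E)%E) ->
  (\int[lebesgue_measure]_(u in (halfline R))
     (q.[u] * (decay b u - decay c u))%:E)%E = 0%E.
Proof.
move=> b0 c0 qn eqbc; set D := halfline R.
have mD : measurable D by exact: measurable_itv.
pose F (e : 'I_n -> R) (j : 'I_(size q)) (u : measurableTypeR R) : \bar R :=
  (u ^+ j * decay e u)%:E.
have iF e j : (forall k, 0 < e k) -> lebesgue_measure.-integrable D (F e j).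
  by move=> e0; apply: integrable_decay => //; rewrite (leq_trans _ qn)// ltnS.
transitivity (\int[lebesgue_measure]_(u in D)
    (\sum_(j < size q) (q`_j)%:E * (F b j u - F c j u)))%E.
  apply: eq_integral => u _; rewrite horner_coef mulr_suml -sumEFin.
  by apply: eq_bigr => j _; rewrite -EFinB -EFinM -mulrBr mulrA.
have iB (j : 'I_(size q)) : lebesgue_measure.-integrable D (F b j \- F c j)%E.
  by apply: integrableB => //; exact: iF.
rewrite integral_sum//; last by move=> j; exact: integrableZl.
apply: big1 => j _.
rewrite (integralZl mD (iB j)) (integralB mD (iF b j b0) (iF c j c0)).
have : (\int[lebesgue_measure]_(u in D) F b j u = \int[lebesgue_measure]_(u in D) F c j u)%E.
  by rewrite -!haar_exprS; apply: eqbc; rewrite /= (leq_trans _ qn)// ltnS.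
move=> ->; rewrite subee ?mule0//; exact: integrable_fin_num (iF c j c0).
Qed.

Lemma horner_prod_XaddC (R : realType) n (b : 'I_n -> R) (t : R) :
  (\prod_k ('X - (- b k)%:P)).[t] = \prod_k (t + b k).
Proof. by rewrite horner_prod; apply: eq_bigr => k _; rewrite hornerXsubC opprK. Qed.

(** See the introduction: if the products differ, their difference is X S, and the
    companion q of S yields a nonnegative function whose integral is 0 by
    [integral_poly_decay] and whose zeros are roots of q(X) S(X^2). *)
Lemma decay_moments_inj (R : realType) n (b c : 'I_n -> R) :
  (forall k, 0 < b k) -> (forall k, 0 < c k) ->
  \prod_k b k = \prod_k c k ->
  (forall i, (1 <= i < n)%N ->
    haar (fun u : R => (u ^+ i)%:E * (decay b u)%:E)%E =
    haar (fun u : R => (u ^+ i)%:E * (decay c u)%:E)%E) ->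
  \prod_k ('X - (- b k)%:P) = \prod_k ('X - (- c k)%:P).
Proof.
move=> b0 c0 bc eqbc; pose P : {poly R} := \prod_k ('X - (- b k)%:P).
pose Q : {poly R} := \prod_k ('X - (- c k)%:P).
apply/eqP; rewrite -/P -/Q -subr_eq0; apply/negPn/negP => PQ0.
have sPQ : (size (P - Q)%R <= n)%N.
  have szE e : size (\prod_(k < n) ('X - (e k)%:P) : {poly R}) = n.+1.
    by rewrite size_prod_XsubC [index_enum _]unlock -enumT size_enum_ord.
  have lcE e : (\prod_(k < n) ('X - (e k)%:P) : {poly R})`_n = 1.
    have := lead_coef_prod_XsubC (index_enum 'I_n) xpredT e.
    by rewrite lead_coefE szE.
  apply/leq_sizeP => j; rewrite leq_eqVlt coefB => /predU1P[<-|nj].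
    by rewrite !lcE subrr.
  by rewrite !nth_default ?subrr ?szE.
have : root (P - Q) 0.
  rewrite /root hornerD hornerN !horner_prod_XaddC subr_eq0.
  by under eq_bigr do rewrite add0r; rewrite bc; under [eqbRHS]eq_bigr do rewrite add0r.
move=> /factor_theorem[S PQE].
have S0 : S != 0 by apply: contra_neq PQ0 => S0; rewrite PQE S0 mul0r.
have sS : size (P - Q) = (size S).+1 by rewrite PQE size_Mmonic ?monicXsubC// size_XsubC addn2.
have [q [q0 sq qS]] := poly_sign_companion S0.
have qn : (size q < n)%N by rewrite (leq_trans _ sPQ)// sS ltnS.
have eqcb i : (1 <= i < n)%N ->
    haar (fun u : R => (u ^+ i)%:E * (decay c u)%:E)%E =
    haar (fun u : R => (u ^+ i)%:E * (decay b u)%:E)%E by move=> /eqbc.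
have T0 : q * (S \Po 'X^2) != 0.
  by rewrite mulf_neq0// comp_poly_eq0// size_polyXn.
pose g (u : measurableTypeR R) : R := q.[u] * (decay c u - decay b u).
have gE u : 0 < u -> exists2 e : R, 0 < e & g u = q.[u] * S.[u ^+ 2] * e.
  move=> u0.
  have u20 : 0 < u ^+ 2 by rewrite exprn_gt0.
  have pos e : (forall k : 'I_n, 0 < e k) -> 0 < \prod_k (u ^+ 2 + e k).
    by move=> e0; exact: prod_addr_gt0 (ltW _).
  pose p := Num.sqrt P.[u ^+ 2]; pose r := Num.sqrt Q.[u ^+ 2].
  have p0 : 0 < p by rewrite sqrtr_gt0 horner_prod_XaddC pos.
  have r0 : 0 < r by rewrite sqrtr_gt0 horner_prod_XaddC pos.
  have pr : p ^+ 2 - r ^+ 2 = S.[u ^+ 2] * u ^+ 2.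
    rewrite !sqr_sqrtr ?horner_prod_XaddC ?ltW ?pos// -!horner_prod_XaddC.
    by rewrite -hornerN -hornerD -/P -/Q PQE hornerM hornerXsubC subr0.
  (* 1/r - 1/p = (p^2 - r^2) / ((p + r) p r), and p^2 - r^2 = u^2 S(u^2) *)
  exists (u ^+ 2 / ((p + r) * p * r)).
    by rewrite divr_gt0// !mulr_gt0// addr_gt0.
  rewrite /g /decay -!horner_prod_XaddC -/P -/Q -/p -/r.
  rewrite -mulrA; congr (_ * _); rewrite mulrA -pr; field.
  by rewrite !gt_eqF// addr_gt0.
have := @integral_neq0_of_roots R g _ T0.
rewrite (integral_poly_decay c0 b0 qn eqcb) eqxx => H.
suff : false by []; apply: H.
- apply: measurable_funM; last by apply: measurable_funB; exact: measurable_decay.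
  rewrite (_ : horner q = fun u => \sum_(j < size q) q`_j * u ^+ j).
    apply: measurable_sum => j; apply: measurable_funM => //; exact: measurable_funX.
  by apply/funext => u; rewrite horner_coef.
- by move=> u u0; have [e e0 ->] := gE u u0; rewrite mulr_ge0 ?qS// ltW.
- move=> u u0; have [e e0 ->] := gE u u0 => /eqP; rewrite mulf_eq0 (gt_eqF e0) orbF.
  by rewrite /root hornerM horner_comp hornerXn.
Qed.

(** * Ellipsoids *)

Section ellipsoid_gauge.
Variables (R : realType) (n : nat) (a : 'I_n -> R) (U : 'M[R]_n).
Hypotheses (a0 : forall i, 0 < a i) (oU : orthogonal_mx U).

(** The homogeneous function whose unit ball is the image by U of the ellipsoid
    with semi-axes a along the coordinate axes. *)
Definition ellipsoid_gauge (x : 'rV[R]_n) : R :=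
  enorm (diag_affine (fun i => (a i)^-1) 0 (x *m U^T)).

Lemma ellipsoid_gauge_sqr x :
  ellipsoid_gauge x ^+ 2 = \sum_i ((a i)^-1 * (x *m U^T) 0 i) ^+ 2.
Proof.
rewrite enorm_sqr; apply: eq_bigr => i _.
by rewrite [diag_affine _ _ _ _ _]mxE [X in _ + X]mxE addr0.
Qed.

Lemma ellipsoid_gaugeE :
  (fun x => x *m U) @` axis_ellipsoid a = [set x | ellipsoid_gauge x <= 1].
Proof.
have gE x : (ellipsoid_gauge x <= 1) = (\sum_i (x *m U^T) 0 i ^+ 2 / a i ^+ 2 <= 1).
  rewrite -(@ler_pXn2r _ 2)// ?nnegrE ?enorm_ge0// expr1n ellipsoid_gauge_sqr.
  by congr (_ <= _); apply: eq_bigr => i _; rewrite exprMn mulrC exprVn.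
have UU : U^T *m U = 1%:M by exact: mulmx1C.
apply/seteqP; split => [_ [x xa <-]|x] /=.
  by rewrite gE -mulmxA oU mulmx1.
by rewrite gE => xa; exists (x *m U^T) => //; rewrite -mulmxA UU mulmx1.
Qed.

Lemma measurable_ellipsoid_gauge : measurable_fun setT ellipsoid_gauge.
Proof.
apply: (measurableT_comp (@measurable_enorm R n)).
apply: (measurableT_comp (measurable_diag_affine _ _)).
exact: measurable_mulmxr.
Qed.

Lemma ellipsoid_gaugeZ (r : R) x : 0 <= r ->
  ellipsoid_gauge (r *: x) = r * ellipsoid_gauge x.
Proof.
move=> r0; rewrite /ellipsoid_gauge -[r in RHS]ger0_norm// -enormZ; congr enorm.
by apply/rowP => i; rewrite -scalemxAl !mxE !addr0 mulrCA.
Qed.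

Lemma ellipsoid_gauge_gt0 x : x != 0 -> 0 < ellipsoid_gauge x.
Proof.
move=> x0; rewrite enorm_gt0; apply: contra_neq x0 => gx0.
have xU : x *m U^T = 0.
  apply/rowP => i; rewrite [RHS]mxE.
  have /rowP/(_ i)/eqP := gx0; rewrite [in X in _ == X -> _]mxE.
  rewrite [diag_affine _ _ _ _ _]mxE [X in _ + X == _]mxE addr0 mulf_eq0 invr_eq0.
  by rewrite gt_eqF//= => /eqP.
by rewrite -[x]mulmx1 -(mulmx1C oU) mulmxA xU mul0mx.
Qed.

Lemma ellipsoid_volume : lebesgue_rV R n [set x | ellipsoid_gauge x <= 1] =
  (lebesgue_rV R n (unit_ball R n) * (\prod_i a i)%:E)%E.
Proof.
have ia0 i : 0 < (a i)^-1 by rewrite invr_gt0.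
rewrite (lebesgue_rV_ellipsoid (orthogonal_mxT oU) ia0) muleC muleA -EFinM.
rewrite -big_split/= big1 ?mul1e => [|i _]; last by rewrite divff// gt_eqF.
congr (lebesgue_rV R n _); apply/seteqP.
suff E x : (ellipsoid_gauge x <= 1) =
    (\sum_i ((a i)^-1 * (x *m U^T) 0 i) ^+ 2 <= 1) by split => x /=; rewrite E.
by rewrite -[LHS](@ler_pXn2r _ 2)// ?nnegrE ?enorm_ge0// expr1n ellipsoid_gauge_sqr.
Qed.

(** In the coordinates x U^T the body is {sum_i (1 + u^2/a_i^2) x_i^2 <= 1}, an
    ellipsoid with inverse semi-axes sqrt (1 + u^2/a_i^2). *)
Lemma ellipsoid_ball_volume (u : R) :
  lebesgue_rV R n [set x | enorm x ^+ 2 + (u * ellipsoid_gauge x) ^+ 2 <= 1] =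
  (lebesgue_rV R n (unit_ball R n) *
    (\prod_i a i * decay (fun i => a i ^+ 2) u)%:E)%E.
Proof.
pose s i := Num.sqrt (1 + (u / a i) ^+ 2).
have s20 i : 0 < 1 + (u / a i) ^+ 2 by rewrite ltr_pwDl// sqr_ge0.
have s0 i : 0 < s i by rewrite sqrtr_gt0.
rewrite (lebesgue_rV_ellipsoid (orthogonal_mxT oU) s0) muleC muleA -EFinM.
have -> : \prod_i a i * decay (fun i => a i ^+ 2) u * \prod_i s i = 1.
  rewrite /decay.
  have -> : Num.sqrt (\prod_k (u ^+ 2 + a k ^+ 2)) = \prod_k a k * \prod_k s k.
    rewrite -big_split/=.
    rewrite -[RHS]ger0_norm ?prodr_ge0// => [|i _]; last by rewrite mulr_ge0 ?ltW.
    rewrite -sqrtr_sqr -prodrXl; congr Num.sqrt; apply: eq_bigr => i _.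
    rewrite exprMn sqr_sqrtr ?ltW// mulrDr mulr1 -exprMn mulrCA divff ?gt_eqF//.
    by rewrite mulr1 addrC.
  have A0 : \prod_k a k != 0 by rewrite gt_eqF// prodr_gt0.
  have S0 : \prod_k s k != 0 by rewrite gt_eqF// prodr_gt0.
  by field; rewrite A0 S0.
rewrite mul1e; congr (lebesgue_rV R n _); apply/seteqP.
suff E x : enorm x ^+ 2 + (u * ellipsoid_gauge x) ^+ 2 =
    \sum_i (s i * (x *m U^T) 0 i) ^+ 2 by split => x /=; rewrite E.
rewrite -(enorm_mulmx x (orthogonal_mxT oU)) enorm_sqr exprMn ellipsoid_gauge_sqr.
rewrite mulr_sumr -big_split/=; apply: eq_bigr => i _.
rewrite exprMn [in RHS]exprMn sqr_sqrtr ?ltW// mulrDl mul1r; congr (_ + _).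
by rewrite exprMn mulrA.
Qed.

End ellipsoid_gauge.

Lemma perm_eq_reindex (T : eqType) n (f g : 'I_n -> T) :
  perm_eq [tuple f i | i < n] [tuple g i | i < n] ->
  exists s : 'S_n, forall i, f i = g (s i).
Proof.
move=> /tuple_permP[s fs]; exists s => i.
have : tnth [tuple f i | i < n] i = tnth [tuple tnth [tuple g i | i < n] (s i) | i < n] i.
  by congr (tnth _ i); exact: val_inj.
by rewrite !tnth_mktuple.
Qed.

Lemma isometry_mulmx (R : realType) n (M : 'M[R]_n) : orthogonal_mx M ->
  is_isometry (fun x => x *m M).
Proof.
move=> oM; split; last by move=> x y; rewrite -mulmxBl enorm_mulmx.
exists (fun x => x *m M^T) => x; first by rewrite -mulmxA oM mulmx1.
by rewrite -mulmxA (mulmx1C oM) mulmx1.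
Qed.

Lemma orthogonal_mxM (R : realType) n (M N : 'M[R]_n) :
  orthogonal_mx M -> orthogonal_mx N -> orthogonal_mx (M *m N).
Proof.
rewrite /orthogonal_mx => oM oN.
by rewrite trmx_mul mulmxA -(mulmxA M) oN mulmx1.
Qed.

Lemma orthogonal_perm_mx (R : realType) n (s : 'S_n) :
  orthogonal_mx (perm_mx s : 'M[R]_n).
Proof. by rewrite /orthogonal_mx tr_perm_mx -perm_mxM mulgV perm_mx1. Qed.

(** Rotate the first ellipsoid to the coordinate axes, permute these, and rotate to
    the second ellipsoid. *)
Lemma congruent_ellipsoids (R : realType) n (a b : 'I_n -> R) (U V : 'M[R]_n)
    (s : 'S_n) : orthogonal_mx U -> orthogonal_mx V ->
  (forall i, a i = b (s i)) ->
  congruent [set x | ellipsoid_gauge a U x <= 1] [set x | ellipsoid_gauge b V x <= 1].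
Proof.
move=> oU oV ab; pose M := U^T *m perm_mx s *m V.
have oM : orthogonal_mx M.
  apply: orthogonal_mxM => //; apply: orthogonal_mxM; last exact: orthogonal_perm_mx.
  exact: orthogonal_mxT.
have gM x : ellipsoid_gauge b V (x *m M) = ellipsoid_gauge a U x.
  apply/eqP; rewrite -(@eqrXn2 _ 2)// ?enorm_ge0// !ellipsoid_gauge_sqr; apply/eqP.
  rewrite (reindex_inj (@perm_inj _ s)); apply: eq_bigr => i _.
  rewrite ab; congr ((_ * _) ^+ 2).
  rewrite /M !mulmxA -[_ *m V *m V^T]mulmxA oV mulmx1.
  by rewrite -[s]invgK -col_permE mxE invgK permK.
exists (fun x => x *m M); first exact: isometry_mulmx.
apply/seteqP; split => [y /= yb|_ [x /= xa <-]]; last by rewrite gM.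
have yM : y *m M^T *m M = y by rewrite -mulmxA (mulmx1C oM) mulmx1.
by exists (y *m M^T) => //=; rewrite -gM yM.
Qed.

(** The n-th dual volumes give the equality of the products of the semi-axes, and
    the others that of the moments in [decay_moments_inj], up to the common
    positive constant c. *)
Lemma gauge_dual_volumes_determine_axes (R : realType) (n : nat)
    (a b : 'I_n -> R) (U V : 'M[R]_n) :
  (0 < n)%N -> (forall i, 0 < a i) -> (forall i, 0 < b i) ->
  orthogonal_mx U -> orthogonal_mx V ->
  (forall i, (1 <= i <= n)%N ->
    dual_volume i [set x | ellipsoid_gauge a U x <= 1] =
    dual_volume i [set x | ellipsoid_gauge b V x <= 1]) ->
  exists s : 'S_n, forall i, a i = b (s i).
Proof.
move=> n0 a0 b0 oU oV hV.
have Kfin := @polar_const_fin_num R n n0.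
have K0 := polar_const_gt0 R n.
have Bfin := lebesgue_rV_ball_fin_num R n.
have B0 := lebesgue_rV_ball_gt0 R n.
have cancel (x y : \bar R) (c : \bar R) : c \is a fin_num -> (0 < c)%E ->
    (c * x = c * y)%E -> x = y.
  move=> cfin c0 /(congr1 (fun z => c^-1 * z)%E).
  by rewrite !muleA mulVe ?mul1e// gt_eqF.
have ab : \prod_i a i = \prod_i b i.
  have := volume_of_dual_volume n0 (measurable_ellipsoid_gauge a U)
    (ellipsoid_gauge_gt0 a0 oU) (@ellipsoid_gaugeZ _ _ a U).
  rewrite hV ?n0 ?leqnn// -(volume_of_dual_volume n0 (measurable_ellipsoid_gauge b V)
    (ellipsoid_gauge_gt0 b0 oV) (@ellipsoid_gaugeZ _ _ b V)).
  move=> /(cancel _ _ _ Kfin K0); rewrite !ellipsoid_volume//.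
  by move=> /(cancel _ _ _ Bfin B0)[].
have sq0 (e : 'I_n -> R) : (forall i, 0 < e i) -> forall i, 0 < e i ^+ 2.
  by move=> e0 i; rewrite exprn_gt0.
have A0 : 0 < \prod_i a i by apply: prodr_gt0.
pose c := (polar_const R n * (lebesgue_rV R n (unit_ball R n) * (\prod_i a i)%:E))%E.
have cfin : c \is a fin_num by rewrite !fin_numM.
have c0 : (0 < c)%E by rewrite !mule_gt0// lte_fin.
have haar_decay (e : 'I_n -> R) (W : 'M[R]_n) i : (forall k, 0 < e k) ->
    orthogonal_mx W -> \prod_k e k = \prod_k a k ->
    (c * haar (fun u : R => (u ^+ i)%:E * (decay (fun k => e k ^+ 2) u)%:E))%E =
    (haar (fun u : R => (u ^+ i)%:E * radial_mass n u) *
      dual_volume i [set x | ellipsoid_gauge e W x <= 1]%R)%E.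
  move=> e0 oW ea.
  rewrite -(haar_dual_volume n0 (measurable_ellipsoid_gauge e W)
    (ellipsoid_gauge_gt0 e0 oW) (@ellipsoid_gaugeZ _ _ e W) i (@measurable_radial_mass R n)
    (@radial_mass_ge0 R n)).
  rewrite -haarZl ?(ltW c0)//.
  - apply: eq_haar => u u0; rewrite muleCA; congr (_ * _)%E.
    rewrite -(volume_ball_gauge u n0 (measurable_ellipsoid_gauge e W)
      (@ellipsoid_gaugeZ _ _ e W)).
    by rewrite ellipsoid_ball_volume// /c ea EFinM !muleA.
  - apply: emeasurable_funM.
      by apply/measurable_EFinP; exact: measurable_funX.
    by apply/measurable_EFinP; exact: measurable_decay.
  - move=> r r0; rewrite -EFinM lee_fin mulr_ge0 ?exprn_ge0 ?(ltW r0)//.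
    by rewrite invr_ge0 sqrtr_ge0.
have : \prod_k ('X - (- a k ^+ 2)%:P) = \prod_k ('X - (- b k ^+ 2)%:P).
  apply: decay_moments_inj; [exact: sq0|exact: sq0|by rewrite !prodrXl ab|].
  move=> i /andP[i0 iltn]; apply: (cancel _ _ _ cfin c0).
  apply: etrans (haar_decay a U i a0 oU erefl) _.
  apply: etrans _ (esym (haar_decay b V i b0 oV (esym ab))).
  have hVi := hV i; rewrite i0 (ltnW iltn) in hVi.
  by rewrite (hVi isT).
move=> prods.
have : perm_eq [tuple - a k ^+ 2 | k < n] [tuple - b k ^+ 2 | k < n].
  apply: prod_XsubC_eq; rewrite !big_tuple.
  under eq_bigr do rewrite tnth_mktuple.
  by under [RHS]eq_bigr do rewrite tnth_mktuple.
move=> /perm_eq_reindex[s abs]; exists s => i.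
by apply/eqP; rewrite -(@eqrXn2 _ 2) ?ltW// -eqr_opp abs.
Qed.

Theorem theorem1 (R : realType) (n : nat) (hn : (2 <= n)%N)
    (E1 E2 : set 'rV[R]_n)
    (hE1 : centered_ellipsoid E1) (hE2 : centered_ellipsoid E2)
    (hV : forall i : nat, (1 <= i <= n)%N -> dual_volume i E1 = dual_volume i E2) :
  congruent E1 E2.
Proof.
case: hE1 hV => a [U [a0 oU ->]]; case: hE2 => b [V [b0 oV ->]].
rewrite !ellipsoid_gaugeE// => hV.
have [s ab] := gauge_dual_volumes_determine_axes (ltnW hn) a0 b0 oU oV hV.
exact: congruent_ellipsoids ab.
Qed.
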